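(* Let $n\ge 2$ be even, let $y\in\tilde I^{\mathsf{FPF}}_n$, and let $p,q\in\mathbb Z$ with $p<q=y(p)$. Then $$\sum_{z\in\Pi^-(y,p)}\hat F^{\mathsf{FPF}}_z=\sum_{z\in\Pi^+(y,q)}\hat F^{\mathsf{FPF}}_z.$$
   Context: The affine symmetric group $\tilde S_n$ is the group of bijections $\pi:\mathbb Z\to\mathbb Z$ with $\pi(i+n)=\pi(i)+n$ for all $i$ and $\pi(1)+\dots+\pi(n)=1+\dots+n$. $s_i$ ($i\in\mathbb Z$) interchanges $i+kn,i+1+kn$ for all $k$ and fixes other integers; $\tilde S_n$ is a Coxeter group with generators $s_1,\dots,s_n$ and length $\ell$. For $i<j$, $j\not\equiv i\pmod n$, $t_{ij}$ exchanges $i+kn$ and $j+kn$ for all $k$ and fixes other integers (these are the reflections). $\tilde I^{\mathsf{FPF}}_n$ is the set of $z\in\tilde S_n$ with $z(z(i))=i\ne z(i)$ for all $i$. Let $\Theta^+=s_1s_3\cdots s_{n-1}$, $\Theta^-=s_2s_4\cdots s_n$; every $z\in\tilde I^{\mathsf{FPF}}_n$ is conjugate in $\tilde S_n$ to exactly one $\Theta\in\{\Theta^+,\Theta^-\}$, and $\mathcal A^{\mathsf{FPF}}(z)$ is the set of minimal-length elements of $\{w\in\tilde S_n: w^{-1}\Theta w=z\}$. Let $\hat\ell_{\mathsf{FPF}}(z)=\frac12(\ell(z)-\frac n2)$. Write $y\lessdot_F z$ if $z=tyt$ for some reflection $t$ and $\hat\ell_{\mathsf{FPF}}(z)=\hat\ell_{\mathsf{FPF}}(y)+1$.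 For $r\in\mathbb Z$: $\Pi^-(y,r)=\{z\in\tilde I^{\mathsf{FPF}}_n: y\lessdot_F z=t_{ir}yt_{ir}\text{ for some } i<r \text{ with } i\notin\{r,y(r)\}+n\mathbb Z\}$, $\Pi^+(y,r)=\{z\in\tilde I^{\mathsf{FPF}}_n: y\lessdot_F z=t_{rj}yt_{rj}\text{ for some } j>r \text{ with } j\notin\{r,y(r)\}+n\mathbb Z\}$. An element $\pi\in\tilde S_n$ is cyclically decreasing if it has a reduced expression $s_{i_1}\cdots s_{i_l}$ with $s_{i_j+1}\ne s_{i_k}$ for all $1\le j<k\le l$. The affine Stanley symmetric function is $F_\pi=\sum x_1^{\ell(\pi^1)}x_2^{\ell(\pi^2)}\cdots$, summed over all factorizations $\pi=\pi^1\pi^2\cdots$ into countably many (possibly identity) cyclically decreasing factors with $\ell(\pi)=\sum_k\ell(\pi^k)$. Finally $\hat F^{\mathsf{FPF}}_z=\sum_{\pi\in\mathcal A^{\mathsf{FPF}}(z)}F_\pi$. *)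

(* Defs.v *)
From HB Require Import structures.
From mathcomp Require Import all_boot all_order all_algebra.
From mathcomp Require Import finmap.
From mathcomp Require Import boolp classical_sets functions cardinality fsbigop.

Set Implicit Arguments.
Unset Strict Implicit.
Unset Printing Implicit Defensive.

Import Order.TTheory GRing.Theory Num.Theory.

Local Open Scope classical_set_scope.
Local Open Scope ring_scope.

Section AffinePermutations.
Variable n : nat.
Implicit Types f g : int -> int.

Definition affine_perm f : Prop :=
  [/\ bijective f,
      forall i : int, f (i + n%:Z) = f i + n%:Z
    & \sum_(1 <= i < n.+1) f i%:Z = \sum_(1 <= i < n.+1) i%:Z].

Record affsym := AffSym { apfun :> int -> int; _ : `[< affine_perm apfun >] }.

HB.instance Definition _ := [isSub for apfun].
HB.instance Definition _ := [Choice of affsym by <:].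

Lemma affsymP (w : affsym) : affine_perm w.
Proof. by case: w => f /= /asboolP. Qed.

Lemma affsym_ext (v w : affsym) : v =1 w -> v = w.
Proof. by move=> vw; apply/val_inj/funext. Qed.

Lemma periodZ f : (forall i : int, f (i + n%:Z) = f i + n%:Z) ->
  forall i k, f (i + k * n%:Z) = f i + k * n%:Z.
Proof.
move=> fp.
have fpn i m : f (i + m%:Z * n%:Z) = f i + m%:Z * n%:Z.
  elim: m => [|m IH]; first by rewrite !mul0r !addr0.
  by rewrite -addn1 PoszD mulrDl mul1r !addrA fp IH.
move=> i [m|m]; first exact: fpn.
rewrite NegzE mulNr; apply/eqP; rewrite -(inj_eq (addIr (m.+1%:Z * n%:Z))).
by rewrite -fpn !subrK.
Qed.

Lemma sum_reindex f (d : int -> int) :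
    injective f -> (forall i : int, f (i + n%:Z) = f i + n%:Z) ->
    (forall i : int, d (i + n%:Z) = d i) ->
  \sum_(1 <= i < n.+1) d (f i%:Z) = \sum_(1 <= i < n.+1) d i%:Z.
Proof.
move=> fI fp dp; rewrite !big_add1 !big_mkord.
case: (posnP n) => [n0|n0]; first by rewrite n0 !big_ord0.
have nZ : (n%:Z != 0 :> int) by case: (n) n0.
have dpZ i k : d (i + k * n%:Z) = d i.
  have dpn j m : d (j + m%:Z * n%:Z) = d j.
    elim: m => [|m IH]; first by rewrite !mul0r !addr0.
    by rewrite -addn1 PoszD mulrDl mul1r !addrA dp IH.
  case: k => m; first exact: dpn.
  by rewrite NegzE mulNr -[LHS](dpn _ m.+1) subrK.
have hlt (i : 'I_n) : (`|((f (i.+1%:Z) - 1) %% n%:Z)%Z| < n)%N.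
  by rewrite -ltz_nat gez0_abs ?modz_ge0 // ltz_pmod.
pose h i := Ordinal (hlt i).
have hE i : (h i).+1%:Z = f i.+1%:Z - ((f (i.+1%:Z) - 1) %/ n%:Z)%Z * n%:Z.
  rewrite -addn1 PoszD /= gez0_abs ?modz_ge0 //.
  by rewrite /modz addrAC subrK.
have hI : injective h.
  move=> i j hij; have := hE i; rewrite hij hE.
  set a := (X in _ - X * _ = _); set b := (X in _ = _ - X * _) => e.
  have : f (i.+1%:Z + (a - b) * n%:Z) = f j.+1%:Z.
    rewrite periodZ // mulrBl addrCA -e; first last.
    by rewrite addrC subrK.
  move=> /fI {}e; apply/val_inj/eqP => /=.
  have : (i%:Z == j%:Z %[mod n%:Z])%Z.
    have -> : j%:Z = (a - b) * n%:Z + i%:Z.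
      apply: (addIr 1); rewrite -addrA -!PoszD !addn1 -e addrC //.
    by rewrite modzMDl.
  by rewrite !modz_nat !modn_small ?ltn_ord.
rewrite [RHS](reindex_inj hI); apply: eq_bigr => i _.
by rewrite hE -mulNr dpZ.
Qed.

Lemma affine_perm_sum f g : affine_perm g ->
    (forall i : int, f (i + n%:Z) = f i + n%:Z) ->
  \sum_(1 <= i < n.+1) f (g i%:Z) = \sum_(1 <= i < n.+1) f i%:Z.
Proof.
move=> [gb gp gs] fp.
have := @sum_reindex g (fun i => f i - i) (bij_inj gb) gp.
rewrite !sumrB gs => /(_ _)/addIr -> // i.
by rewrite fp opprD addrACA subrr addr0.
Qed.

Fact affsym1_subproof : `[< affine_perm id >].
Proof. by apply/asboolP; split => //; exists id. Qed.
Definition affsym1 := AffSym affsym1_subproof.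

Fact affsymM_subproof (v w : affsym) : `[< affine_perm (v \o w) >].
Proof.
apply/asboolP; case: (affsymP v) (affsymP w) => vb vp vs [wb wp ws].
split=> [|i|] /=; [exact: bij_comp | by rewrite wp vp |].
by rewrite affine_perm_sum // -vs.
Qed.
Definition affsymM v w := AffSym (affsymM_subproof v w).

Fact affsymV_subproof (w : affsym) :
  `[< affine_perm (fun i : int => xget (0 : int) [set j : int | w j = i]) >].
Proof.
apply/asboolP; case: (affsymP w) => wb wp ws; set g := fun i => _.
have [g' g'K wK] := wb.
have gE : g = g'.
  by apply/funext => i; apply: (bij_inj wb); rewrite wK;
     rewrite /g; have := @xgetI _ 0 [set j | w j = i] _ (wK i).
rewrite gE; have gp i : g' (i + n%:Z) = g' i + n%:Z.
  by apply: (bij_inj wb); rewrite wp !wK.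
split => //; first by exists w.
rewrite -(@affine_perm_sum g' w) //.
by apply: eq_bigr => i _; rewrite g'K.
Qed.
Definition affsymV w := AffSym (affsymV_subproof w).

Fact affsymA : associative affsymM.
Proof. by move=> u v w; apply: affsym_ext. Qed.
Fact affsym1M : left_id affsym1 affsymM.
Proof. by move=> w; apply: affsym_ext. Qed.
Fact affsymM1 : right_id affsym1 affsymM.
Proof. by move=> w; apply: affsym_ext. Qed.
Fact affsymVM : left_inverse affsym1 affsymV affsymM.
Proof.
move=> w; apply: affsym_ext => i /=; case: (affsymP w) => wb _ _.
by apply: (bij_inj wb); have := @xgetI _ (0 : int) [set j | w j = w i] _ erefl.
Qed.
Fact affsymMV : right_inverse affsym1 affsymV affsymM.
Proof.
move=> w; apply: affsym_ext => i /=; case: (affsymP w) => -[g _ wK] _ _.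
by have := @xgetI _ (0 : int) [set j | w j = i] _ (wK i).
Qed.

HB.instance Definition _ :=
  isGroup.Build affsym affsymA affsym1M affsymM1 affsymVM affsymMV.

Lemma affsym_mulE (v w : affsym) i : (v * w)%g i = v (w i).
Proof. by []. Qed.

End AffinePermutations.

Section Reflections.
Variable n : nat.

Definition swap_fun (i j x : int) : int :=
  if (x == i %[mod n])%Z then x + (j - i)
  else if (x == j %[mod n])%Z then x + (i - j) else x.

(* The default 1 is never used when i and j are distinct modulo n: see
   [aff_reflE]. *)
Definition aff_refl (i j : int) : affsym n :=
  insubd (1%g : affsym n) (swap_fun i j).

Definition simple_refl (i : int) : affsym n := aff_refl i (i + 1).

Lemma aff_reflE (i j : int) : (i != j %[mod n])%Z ->
  aff_refl i j =1 swap_fun i j.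
Proof.
move=> ij x; suff swapP : `[< affine_perm n (swap_fun i j) >].
  exact: (congr1 (fun f : int -> int => f x) (insubdK (1%g : affsym n) swapP)).
apply/asboolP.
have dvdE a b : (a == b %[mod n])%Z = (n %| a - b)%Z by rewrite eqz_mod_dvd.
have e1 a : (a + (j - i) == j %[mod n])%Z = (a == i %[mod n])%Z.
  by rewrite !dvdE -addrA [j - i - j]addrAC subrr sub0r.
have e2 a : (a + (i - j) == i %[mod n])%Z = (a == j %[mod n])%Z.
  by rewrite !dvdE -addrA [i - j - i]addrAC subrr sub0r.
have inv : involutive (swap_fun i j).
  move=> a; rewrite /swap_fun.
  case: (eqVneq (a %% n)%Z (i %% n)%Z) => [ai|ai].
    rewrite e1 ai eqxx ifF.
      by rewrite -[i - j]opprB addrK.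
    apply/negbTE; apply: contraNneq ij => e; rewrite -e.
    by move: (e1 a); rewrite ai eqxx => /eqP ->; rewrite eqxx.
  case: (eqVneq (a %% n)%Z (j %% n)%Z) => [aj|aj].
    by rewrite e2 aj eqxx -[j - i]opprB addrK.
  by rewrite (negbTE ai) (negbTE aj).
have per a : swap_fun i j (a + n%:Z) = swap_fun i j a + n%:Z.
  by rewrite /swap_fun !modzDr; do 2?[case: ifP => _]; rewrite // addrAC.
split => //; first exact: inv_bij.
pose chi k a : int := ((a == k %[mod n])%Z : nat)%:Z.
have swapE a : swap_fun i j a = a + (j - i) * (chi i a - chi j a).
  rewrite /swap_fun /chi; case: (eqVneq (a %% n)%Z (i %% n)%Z) => [ai|ai].
    by rewrite ai (negbTE ij) subr0 mulr1.
  by case: eqP => _; rewrite ?subrr ?mulr0 ?addr0 // sub0r mulrN1 opprB.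
under eq_bigr do rewrite swapE.
rewrite big_split -[RHS]addr0 /=; congr (_ + _).
rewrite -mulr_sumr sumrB.
suff -> : \sum_(1 <= k < n.+1) chi i k%:Z = \sum_(1 <= k < n.+1) chi j k%:Z.
  by rewrite subrr mulr0.
rewrite -(@sum_reindex n (fun a => a + (j - i)) (chi j)).
- by apply: eq_bigr => k _; rewrite /chi e1.
- exact: addIr.
- by move=> a; rewrite addrAC.
- by move=> a; rewrite /chi modzDr.
Qed.

End Reflections.

Section Length.
Variable n : nat.
Implicit Types (w : affsym n) (a : seq int).

Definition word a : affsym n := (\prod_(i <- a) simple_refl n i)%g.

Definition reduced_word w : set (seq int) :=
  [set a | word a = w /\ forall b, word b = w -> (size a <= size b)%N].

(* The simple reflections generate the group, so reduced words exist. *)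
Definition len w : nat := size (xget [::] (reduced_word w)).

Definition is_reflection w : Prop :=
  exists i j : int, [/\ i < j, (j != i %[mod n])%Z & w = aff_refl n i j].

Definition cyc_decreasing w : Prop :=
  exists2 a, reduced_word w a &
    forall j k : nat, (j < k)%N -> (k < size a)%N ->
      simple_refl n (a`_j + 1) != simple_refl n a`_k.

End Length.

Section StanleySymmetricFunctions.
Variable n : nat.

(* Formal power series over the integers in x_0, x_1, x_2, ... ; a monomial is
   its finitely supported exponent function. *)
Definition monom := {fsfun nat -> nat with 0%N}.
Definition power_series := monom -> int.
HB.instance Definition _ := GRing.Zmodule.on power_series.

(* All but finitely many factors are trivial, since the lengths have a finite
   sum. *)
Definition cyc_factorization (w : affsym n) (f : nat -> affsym n) : Prop :=
  (forall k, cyc_decreasing (f k)) /\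
  exists N : nat, [/\ forall k, (N <= k)%N -> f k = 1%g,
    (\prod_(0 <= k < N) f k)%g = w
    & (\sum_(0 <= k < N) len (f k))%N = len w].

(* The coefficient of x^m counts the factorizations whose k-th factor has
   length m k. *)
Definition affine_stanley (w : affsym n) : power_series := fun m =>
  \sum_(f \in [set f | cyc_factorization w f /\ forall k, len (f k) = m k])
    (1 : int).

End StanleySymmetricFunctions.

Section FPFInvolutions.
Variable n : nat.
Implicit Types (y z : affsym n) (r : int).

Definition fpf_invol : set (affsym n) :=
  [set z | forall i, z (z i) = i /\ z i <> i].

Definition Theta_plus : affsym n :=
  (\prod_(0 <= k < n./2) simple_refl n (2 * k + 1)%N)%g.
Definition Theta_minus : affsym n :=
  (\prod_(0 <= k < n./2) simple_refl n (2 * k + 2)%N)%g.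

(* Every z in [fpf_invol] is conjugate to exactly one of the two Thetas, so at
   most one of them contributes. *)
Definition fpf_atoms z : set (affsym n) :=
  [set w | exists2 Theta, Theta = Theta_plus \/ Theta = Theta_minus &
     (w^-1 * Theta * w)%g = z /\
     forall v, (v^-1 * Theta * v)%g = z -> (len w <= len v)%N].

Definition fpf_len z : rat := ((len z)%:R - n%:R / 2%:R) / 2%:R.

Definition fpf_cover y z : Prop :=
  (exists2 t, is_reflection t & z = (t * y * t)%g) /\
  fpf_len z = fpf_len y + 1.

Definition Pi_minus y r : set (affsym n) :=
  [set z | [/\ fpf_invol z, fpf_cover y z &
    exists i : int, [/\ i < r, (i != r %[mod n])%Z, (i != y r %[mod n])%Z
      & z = (aff_refl n i r * y * aff_refl n i r)%g]]].

Definition Pi_plus y r : set (affsym n) :=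
  [set z | [/\ fpf_invol z, fpf_cover y z &
    exists j : int, [/\ r < j, (j != r %[mod n])%Z, (j != y r %[mod n])%Z
      & z = (aff_refl n r j * y * aff_refl n r j)%g]]].

Definition fpf_stanley z : power_series :=
  \sum_(w \in fpf_atoms z) affine_stanley w.

End FPFInvolutions.

(* Main.v *)
(* Write d_I for the cyclically decreasing element of a proper subset I of Z/n.
   The coefficient of x^m in the Stanley function of z counts the sequences
   (I_k) with |I_k| = m_k such that conjugating Theta by the product of the d_(I_k)
   gives z and raises the length by the maximal amount, 2 sum m_k.
   For y and p let weight(x) = [x = p] + [x = y p] (mod n), and let Phi be the
   indicator of Pi^+(y, y p) minus that of Pi^-(y, p).
   (i) The lifting property of covers gives a Leibniz rule: moving a conjugation by
   s_i from the argument of Phi to its base point y costs weight(i) - weight(i + 1)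
   when z = y, and nothing otherwise.  Iterated along a word, the corrections are
   indexed by the deleted letters.
   (ii) Summed over all I of a given size, these corrections cancel: deleting i from
   d_I leaves J = I - {i} with coefficient weight(d_J^-1 i) - weight(i + 1), and the
   sum of these over i outside J vanishes since d_J (j + 1) = j for j in J.
   Hence Phi can be moved through all the factors down to Theta, where it vanishes
   because Theta has minimal length in its conjugacy class. *)

Require Import Defs.
From HB Require Import structures.
From mathcomp Require Import all_boot all_order all_algebra.
From mathcomp Require Import finmap boolp classical_sets functions cardinality fsbigop.
From mathcomp Require Import zify ring lra.

Set Implicit Arguments.
Unset Strict Implicit.
Unset Printing Implicit Defensive.
Set SsrOldRewriteGoalsOrder.

Import Order.TTheory GRing.Theory Num.Theory.

Local Open Scope ring_scope.

(** * Reflections and words *)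

Section Basics.
Variable n : nat.
Hypothesis n_gt1 : (1 < n)%N.
Implicit Types (w y z : affsym n) (i j a b x : int).

Lemma n_neq0 : (n%:Z != 0).
Proof. by case: n n_gt1. Qed.

Lemma modeqP x a : reflect (exists k : int, x = a + k * n%:Z)
  (x == a %[mod n])%Z.
Proof.
rewrite eqz_mod_dvd; apply: (iffP dvdzP) => -[k e]; exists k.
  by rewrite -e addrC subrK.
by rewrite e addrC addKr.
Qed.

Lemma apZ w x k : w (x + k * n%:Z) = w x + k * n%:Z.
Proof. by case: (affsymP w) => _ h _; apply: periodZ. Qed.

Lemma ap_inj w : injective w.
Proof. by case: (affsymP w) => /bij_inj. Qed.

Lemma apVK w x : (w^-1)%g (w x) = x.
Proof. by rewrite -affsym_mulE mulVg. Qed.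

Lemma apKV w x : w ((w^-1)%g x) = x.
Proof. by rewrite -affsym_mulE mulgV. Qed.

Lemma ap_mod w x a : (w x == w a %[mod n])%Z = (x == a %[mod n])%Z.
Proof.
apply/modeqP/modeqP => -[k]; first (rewrite -apZ; first by move/ap_inj; exists k).
by move=> ->; exists k; rewrite apZ.
Qed.

Lemma eqmod_sym x a : (x == a %[mod n])%Z = (a == x %[mod n])%Z.
Proof. exact: eq_sym. Qed.

Lemma eqmodZ x a k : (x + k * n%:Z == a %[mod n])%Z = (x == a %[mod n])%Z.
Proof. by rewrite addrC modzMDl. Qed.

Lemma succ_neqmod i : (i != i + 1 %[mod n])%Z.
Proof.
apply/negP; rewrite eqz_mod_dvd opprD addrA subrr add0r dvdzE /= dvdn1.
by case: n n_gt1 => // -[].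
Qed.

Lemma reflL i j k : (i != j %[mod n])%Z -> aff_refl n i j (i + k * n%:Z) = j + k * n%:Z.
Proof. by move=> ij; rewrite aff_reflE // /swap_fun eqmodZ eqxx; ring. Qed.

Lemma reflR i j k : (i != j %[mod n])%Z -> aff_refl n i j (j + k * n%:Z) = i + k * n%:Z.
Proof.
move=> ij; rewrite aff_reflE // /swap_fun !eqmodZ eqxx.
by rewrite eqmod_sym (negbTE ij); ring.
Qed.

Lemma reflO i j x : (i != j %[mod n])%Z -> (x != i %[mod n])%Z ->
  (x != j %[mod n])%Z -> aff_refl n i j x = x.
Proof. by move=> ij /negbTE xi /negbTE xj; rewrite aff_reflE // /swap_fun xi xj. Qed.

Lemma reflL0 i j : (i != j %[mod n])%Z -> aff_refl n i j i = j.
Proof. by move=> ij; have := @reflL i j 0 ij; rewrite !mul0r !addr0. Qed.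

Lemma reflR0 i j : (i != j %[mod n])%Z -> aff_refl n i j j = i.
Proof. by move=> ij; have := @reflR i j 0 ij; rewrite !mul0r !addr0. Qed.

Variant refl_spec i j x : int -> Type :=
| ReflL k of x = i + k * n%:Z : refl_spec i j x (j + k * n%:Z)
| ReflR k of x = j + k * n%:Z : refl_spec i j x (i + k * n%:Z)
| ReflO of (x != i %[mod n])%Z & (x != j %[mod n])%Z : refl_spec i j x x.

Lemma reflP i j x : (i != j %[mod n])%Z -> refl_spec i j x (aff_refl n i j x).
Proof.
move=> ij; have [/modeqP/cid[k ->]|xi] := boolP (x == i %[mod n])%Z.
  by rewrite reflL //; apply: ReflL.
have [/modeqP/cid[k ->]|xj] := boolP (x == j %[mod n])%Z.
  by rewrite reflR //; apply: ReflR.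
by rewrite reflO //; apply: ReflO.
Qed.

Lemma reflC i j : (i != j %[mod n])%Z -> aff_refl n i j = aff_refl n j i.
Proof.
move=> ij; have ji : (j != i %[mod n])%Z by rewrite eqmod_sym.
apply: affsym_ext => x; case: (reflP x ij) => [k ->|k ->|xi xj].
- by rewrite reflR.
- by rewrite reflL.
- by rewrite reflO.
Qed.

Lemma reflK i j : (i != j %[mod n])%Z -> (aff_refl n i j * aff_refl n i j = 1)%g.
Proof.
move=> ij; apply: affsym_ext => x; rewrite affsym_mulE.
by case: (reflP x ij) => [k ->|k ->|xi xj]; rewrite ?reflR ?reflL ?reflO.
Qed.

Lemma reflV i j : (i != j %[mod n])%Z -> ((aff_refl n i j)^-1 = aff_refl n i j)%g.
Proof. by move=> ij; apply: mulg1_eq; rewrite reflK. Qed.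

Lemma reflJ w i j : (i != j %[mod n])%Z ->
  (w * aff_refl n i j * w^-1 = aff_refl n (w i) (w j))%g.
Proof.
move=> ij; have wij : (w i != w j %[mod n])%Z by rewrite ap_mod.
apply: affsym_ext => x; rewrite -[x](apKV w); move: ((w^-1)%g x) => {}x.
rewrite !affsym_mulE apVK; case: (reflP x ij) => [k ->|k ->|xi xj].
- by rewrite !(apZ w) reflL.
- by rewrite !(apZ w) reflR.
- by rewrite reflO ?ap_mod.
Qed.

Lemma reflZ i j k : (i != j %[mod n])%Z ->
  aff_refl n (i + k * n%:Z) (j + k * n%:Z) = aff_refl n i j.
Proof.
move=> ij; have ijk : (i + k * n%:Z != j + k * n%:Z %[mod n])%Z.
  by rewrite eqmodZ eqmod_sym eqmodZ eqmod_sym.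
apply: affsym_ext => x; case: (reflP x ij) => [l ->|l ->|xi xj].
- rewrite (_ : i + l * n%:Z = i + k * n%:Z + (l - k) * n%:Z); last by ring.
  by rewrite reflL //; ring.
- rewrite (_ : j + l * n%:Z = j + k * n%:Z + (l - k) * n%:Z); last by ring.
  by rewrite reflR //; ring.
- by rewrite reflO // eqmod_sym eqmodZ eqmod_sym.
Qed.

(** * Simple reflections and words in them *)

Local Notation s := (simple_refl n).

Lemma simpleK i : (s i * s i = 1)%g.
Proof. exact/reflK/succ_neqmod. Qed.

Lemma simpleV i : ((s i)^-1 = s i)%g.
Proof. exact/reflV/succ_neqmod. Qed.

Lemma simpleKK i x : s i (s i x) = x.
Proof. by rewrite -affsym_mulE simpleK. Qed.

Variant simple_spec i x : int -> Type :=
| SimpleL k of x = i + k * n%:Z : simple_spec i x (x + 1)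
| SimpleR k of x = i + 1 + k * n%:Z : simple_spec i x (x - 1)
| SimpleO of (x != i %[mod n])%Z & (x != i + 1 %[mod n])%Z : simple_spec i x x.

Lemma simpleP i x : simple_spec i x (s i x).
Proof.
rewrite /simple_refl; case: (reflP x (succ_neqmod i)) => [k e|k e|xi xj].
- by rewrite addrAC -e; apply: (@SimpleL i x k).
- rewrite (_ : i + _ = x - 1); last by rewrite e; ring.
  exact: (@SimpleR i x k).
- exact: SimpleO.
Qed.

Lemma simpleL i : s i i = i + 1.
Proof. exact/reflL0/succ_neqmod. Qed.

Lemma simpleR i : s i (i + 1) = i.
Proof. exact/reflR0/succ_neqmod. Qed.

Lemma simpleO i x : (x != i %[mod n])%Z -> (x != i + 1 %[mod n])%Z -> s i x = x.
Proof. exact/reflO/succ_neqmod. Qed.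

Lemma simple_mod i j : (i == j %[mod n])%Z -> s i = s j.
Proof.
case/modeqP => k ->; rewrite /simple_refl addrAC reflZ //; exact: succ_neqmod.
Qed.

Lemma simple_inj i j : s i = s j -> (i == j %[mod n])%Z.
Proof.
move=> e; move: (simpleL i); rewrite e; case: simpleP => [k ->|k _|_ _]; last 2 first.
- lia.
- lia.
by rewrite eqmodZ.
Qed.

(* A simple reflection moves integers by at most 1, so it can only reverse the
   order of two neighbours that it exchanges. *)
Lemma simple_flip i a b : a < b -> s i b <= s i a ->
  exists k, a = i + k * n%:Z /\ b = i + 1 + k * n%:Z.
Proof.
move=> ab; have : s i a != s i b by rewrite (inj_eq (@ap_inj _)) lt_eqF.
case: (simpleP i a) => [k ea|k ea|_ _]; case: (simpleP i b) => [l eb|l eb|_ _] ne h.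
all: try lia.
have e : b = a + 1 by lia.
by exists k; split => //; rewrite e ea; ring.
Qed.

Lemma simple_flip_refl i a b : a < b -> s i b <= s i a ->
  aff_refl n a b = s i.
Proof.
move=> ab /(simple_flip ab)[k [-> ->]].
by rewrite /simple_refl reflZ //; exact: succ_neqmod.
Qed.

Lemma simple_comm i j : (i != j %[mod n])%Z -> (i + 1 != j %[mod n])%Z ->
  (i != j + 1 %[mod n])%Z -> (s i * s j = s j * s i)%g.
Proof.
move=> ij i1j ij1.
have i1j1 : (i + 1 != j + 1 %[mod n])%Z.
  by move: ij; rewrite !eqz_mod_dvd opprD addrACA subrr addr0.
have : (s i * s j * (s i)^-1 = s j)%g.
  by rewrite {1}/simple_refl reflJ ?succ_neqmod // !simpleO // eqmod_sym.
by rewrite simpleV => e; rewrite -{2}e -mulgA simpleK mulg1.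
Qed.

Local Notation word := (word n).

Lemma word_nil : word [::] = 1%g.
Proof. by rewrite /Defs.word big_nil. Qed.

Lemma word_cons i (a : seq int) : word (i :: a) = (s i * word a)%g.
Proof. by rewrite /Defs.word big_cons. Qed.

Lemma word_cat (a b : seq int) : word (a ++ b) = (word a * word b)%g.
Proof. by rewrite /Defs.word big_cat. Qed.

Lemma word_rcons i (a : seq int) : word (rcons a i) = (word a * s i)%g.
Proof. by rewrite -cats1 word_cat word_cons word_nil mulg1. Qed.

Lemma word_rev (a : seq int) : (word (rev a) = (word a)^-1)%g.
Proof.
elim: a => [|i a IH]; first by rewrite /= word_nil invg1.
by rewrite rev_cons word_rcons IH word_cons invgM simpleV.
Qed.

End Basics.

(** * Length and strong exchange *)

Section Length.
Variable n : nat.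
Hypothesis n_gt1 : (1 < n)%N.
Implicit Types (w y z : affsym n) (i j x : int) (a b : seq int).
Local Notation s := (simple_refl n).
Local Notation word := (word n).

Lemma sum_two_classes (d : int -> int) i :
    (forall x, d (x + n%:Z) = d x) ->
    (forall x, (x != i %[mod n])%Z -> (x != i + 1 %[mod n])%Z -> d x = 0) ->
  \sum_(1 <= j < n.+1) d j%:Z = d i + d (i + 1).
Proof.
move=> dp d0.
(* Shift the window so that its first two terms are [i] and [i + 1]. *)
rewrite -(@sum_reindex n (fun x => x + (i - 1)) d) //; first last.
- by move=> x; rewrite addrAC.
- exact: addIr.
rewrite big_ltn ?ltnS 1?ltnW // big_ltn ?ltnS // big_nat_cond big1 => [|k].
  by rewrite addr0; congr (d _ + d _); ring.
rewrite andbT => /andP[k2 kn]; apply: d0.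
  rewrite (_ : k%:Z + _ = i + (k - 1)%N%:Z); last by lia.
  rewrite -[X in (_ != X %% _)%Z]addr0 eqz_modDl; apply/negP => /eqP.
  by rewrite mod0z !modz_nat => -[]; rewrite modn_small; lia.
rewrite (_ : k%:Z + _ = i + 1 + (k - 2)%N%:Z); last by lia.
rewrite -[X in (_ != X %% _)%Z]addr0 eqz_modDl; apply/negP => /eqP.
by rewrite mod0z !modz_nat => -[]; rewrite modn_small; lia.
Qed.

(** This is the termination measure used to write an element as a word in the simple reflections. *)
Definition displacement w : int := \sum_(1 <= j < n.+1) (w j%:Z - j%:Z) ^+ 2.

(** After reindexing by [s i] only the classes of [i] and [i + 1] contribute, and the change is
    [2 * (w (i + 1) - w i)]. *)
Lemma displacement_descent w i : w (i + 1) < w i ->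
  displacement (w * s i)%g < displacement w.
Proof.
move=> desc; rewrite -subr_lt0 /displacement.
have sp x : s i (x + n%:Z) = s i x + n%:Z by have := apZ (s i) x 1; rewrite mul1r.
have wp x : w (x + n%:Z) = w x + n%:Z by have := apZ w x 1; rewrite mul1r.
have -> : \sum_(1 <= j < n.+1) ((w * s i)%g j%:Z - j%:Z) ^+ 2 =
          \sum_(1 <= j < n.+1) (w j%:Z - s i j%:Z) ^+ 2.
  rewrite -(@sum_reindex n (s i) (fun x => (w x - s i x) ^+ 2)) //.
  - by apply: eq_bigr => j _; rewrite simpleKK.
  - exact: ap_inj.
  - by move=> x; rewrite wp sp opprD addrACA subrr addr0.
rewrite -sumrB (@sum_two_classes (fun x => (w x - s i x) ^+ 2 - (w x - x) ^+ 2) i).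
- rewrite simpleL // simpleR //; move: (w i) (w (i + 1)) desc => u v desc.
  rewrite (_ : (u - (i + 1)) ^+ 2 - (u - i) ^+ 2 + ((v - i) ^+ 2
    - (v - (i + 1)) ^+ 2) = 2 * (v - u)); last by ring.
  by lia.
- by move=> x; rewrite wp sp; congr (_ ^+ 2 - _ ^+ 2);
     rewrite opprD addrACA subrr addr0.
- by move=> x xi xi1; rewrite simpleO // subrr.
Qed.

(** Every step is at least 1 and the [n] steps of a period add up to [n], so [w] is a translation;
    the normalized sum then makes it trivial. *)
Lemma no_descent_id w : (forall i, w i < w (i + 1)) -> w = 1%g.
Proof.
move=> asc.
have ge x (k : nat) : w x + k%:Z <= w (x + k%:Z).
  elim: k => [|k IH]; first by rewrite !addr0.
  have := asc (x + k%:Z); rewrite (_ : x + k.+1%:Z = x + k%:Z + 1); lia.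
have succ x : w (x + 1) = w x + 1.
  have := ge (x + 1) (n - 1)%N; have := asc x.
  rewrite (_ : x + 1 + (n - 1)%N%:Z = x + 1 * n%:Z); last by lia.
  by rewrite apZ; lia.
have w_nat (k : nat) : w k%:Z = w 0 + k%:Z.
  elim: k => [|k IH]; first by rewrite addr0.
  by rewrite -addn1 PoszD succ IH addrA.
have w0 : w 0 = 0.
  have [_ _] := affsymP w.
  under eq_bigr do rewrite w_nat.
  rewrite big_split /= -[RHS]add0r => /addIr.
  rewrite sumr_const_nat subn1 /= => /eqP; rewrite mulrn_eq0.
  by case/orP => /eqP // n0; exfalso; move: n_gt1; rewrite n0.
apply: affsym_ext => x; rewrite (divz_eq x n) addrC apZ.
have : 0 <= (x %% n)%Z by rewrite modz_ge0 // n_neq0.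
by case: (x %% n)%Z => // k _; rewrite w_nat w0 add0r.
Qed.

Lemma ex_word w : exists a, word a = w.
Proof.
have [N] := ubnP `|displacement w|%N; elim: N w => // N IH w lt_wN.
have [/no_descent_id ->|] := EM (forall i, w i < w (i + 1)).
  by exists [::]; rewrite word_nil.
move=> /existsNP[i /negP]; rewrite -leNgt le_eqVlt => /orP[/eqP /ap_inj|]; first by lia.
move=> desc; have lt := displacement_descent desc.
have ge0 : 0 <= displacement (w * s i)%g by apply: sumr_ge0 => j _; apply: sqr_ge0.
have [|a e] := IH (w * s i)%g; first by lia.
by exists (rcons a i); rewrite word_rcons e -mulgA simpleK // mulg1.
Qed.

(** Words exist by [ex_word], hence also shortest ones, so the default of [xget] in [len] is never
    reached. *)
Lemma len_reducedP w : reduced_word w (xget [::] (reduced_word w)).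
Proof.
apply: xgetPex; have [a0 e0] := ex_word w.
have ex : exists k, `[< exists2 a, word a = w & size a = k >].
  by exists (size a0); apply/asboolP; exists a0.
case: (ex_minnP ex) => k /asboolP[a wa <-] mina; exists a; split=> // b wb.
by apply: mina; apply/asboolP; exists b.
Qed.

Lemma ex_reduced w : exists2 a, word a = w & size a = len w.
Proof. by have [] := len_reducedP w; exists (xget [::] (reduced_word w)). Qed.

Lemma len_word a : (len (word a) <= size a)%N.
Proof. by have [_] := len_reducedP (word a); apply. Qed.

Lemma reduced_wordP w a : reduced_word w a <-> word a = w /\ size a = len w.
Proof.
split=> [[wa mina]|[wa e]].
  split=> //; have [b wb sb] := ex_reduced w; apply/eqP; rewrite eqn_leq.
  by rewrite -{2}wa len_word andbT -sb; apply: mina.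
by split=> // b wb; rewrite e -wb len_word.
Qed.

Lemma lenM v w : (len (v * w)%g <= len v + len w)%N.
Proof.
have [a <- <-] := ex_reduced v; have [b <- <-] := ex_reduced w.
by rewrite -word_cat -size_cat len_word.
Qed.

Lemma len1 : len (1%g : affsym n) = 0%N.
Proof. by apply/eqP; rewrite -leqn0 -(word_nil n) (len_word [::]). Qed.

Lemma len_eq0 w : len w = 0%N -> w = 1%g.
Proof.
have [a <- <-] := ex_reduced w; by case: a => // _; rewrite word_nil.
Qed.

Lemma lenV w : len (w^-1)%g = len w.
Proof.
have le (v : affsym n) : (len (v^-1)%g <= len v)%N.
  by have [a <- <-] := ex_reduced v; rewrite -word_rev // -(size_rev a) len_word.
by apply/eqP; rewrite eqn_leq le -{1}[w]invgK le.
Qed.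

Lemma len_simple i : (len (s i) <= 1)%N.
Proof. by have := len_word [:: i]; rewrite word_cons word_nil mulg1. Qed.

(* Strong exchange: following the pair i < j through the letters, the
   letter that reverses it can be deleted. *)
Lemma word_exchange a i j : (i != j %[mod n])%Z -> i < j ->
    word a j <= word a i ->
  exists2 b, (size b < size a)%N & word b = (word a * aff_refl n i j)%g.
Proof.
move=> ij ltij; elim: a => [|x a IH]; first by rewrite word_nil /= leNgt ltij.
have [le_ji _|lt_ij] := leP (word a j) (word a i).
  have [b lt_b wb] := IH le_ji; exists (x :: b) => //.
  by rewrite !word_cons wb mulgA.
rewrite word_cons !affsym_mulE => flip; exists a => //.
have := simple_flip_refl n_gt1 lt_ij flip.
by rewrite -reflJ // => <-; rewrite -!mulgA mulKg reflK // mulg1.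
Qed.

Lemma len_refl_lt w i j : (i != j %[mod n])%Z -> i < j -> w j < w i ->
  (len (w * aff_refl n i j)%g < len w)%N.
Proof.
have [a <- <-] := ex_reduced w => ij ltij /ltW/(word_exchange ij ltij)[b lt_b <-].
exact: leq_ltn_trans (len_word b) lt_b.
Qed.

Lemma len_refl_gt w i j : (i != j %[mod n])%Z -> i < j -> w i < w j ->
  (len w < len (w * aff_refl n i j)%g)%N.
Proof.
move=> ij ltij asc; have := @len_refl_lt (w * aff_refl n i j)%g _ _ ij ltij.
by rewrite -mulgA reflK // mulg1 !affsym_mulE reflL0 // reflR0 //; apply.
Qed.

Lemma len_asc w i : w i < w (i + 1) -> len (w * s i)%g = (len w).+1.
Proof.
move=> asc; apply/eqP; rewrite eqn_leq len_refl_gt ?succ_neqmod ?ltrDl // andbT.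
by rewrite -addn1 (leq_trans (lenM _ _)) // leq_add2l len_simple.
Qed.

End Length.

(** * Covers of fixed-point-free involutions *)

Section FixedPointFree.
Variable n : nat.
Hypothesis n_gt1 : (1 < n)%N.
Implicit Types (w y z : affsym n) (i j r p x : int) (e : bool).
Local Notation s := (simple_refl n).
Local Notation t := (aff_refl n).

Lemma fpfK y x : fpf_invol y -> y (y x) = x.
Proof. by move=> /(_ x)[]. Qed.

Lemma fpfV y : fpf_invol y -> (y^-1 = y)%g.
Proof. by move=> fy; apply: mulg1_eq; apply: affsym_ext => x; rewrite affsym_mulE fpfK. Qed.

(** If [y x = x + kn], applying [y] again gives [x = x + 2kn], so [k = 0] and [x] would be fixed. *)
Lemma fpf_neqmod y x : fpf_invol y -> (y x != x %[mod n])%Z.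
Proof.
move=> fy; apply/negP => /modeqP[k e]; have := fpfK x fy; rewrite e apZ e.
have [_ /[swap] h []] := fy x; rewrite e.
have : k * n%:Z = 0 by lia.
by move=> ->; rewrite addr0.
Qed.

Lemma fpf_conj y w : fpf_invol y -> fpf_invol (y ^ w)%g.
Proof.
move=> fy x; rewrite !conjgE !affsym_mulE; split; first by rewrite apKV fpfK // apVK.
move=> /(congr1 w); rewrite apKV => e.
by have := fpf_neqmod (w x) fy; rewrite e eqxx.
Qed.

Lemma conj_refl y i j : (i != j %[mod n])%Z -> (t i j * y * t i j = y ^ t i j)%g.
Proof. by move=> ij; rewrite conjgE reflV // mulgA. Qed.

Lemma conj_simpleE y i : (y ^ s i = s i * y * s i)%g.
Proof. by rewrite -conj_refl // succ_neqmod. Qed.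

Lemma conj_simpleK y i : ((y ^ s i) ^ s i = y)%g.
Proof. by rewrite -conjgM simpleK // conjg1. Qed.

Lemma len_conj z w : (len (z ^ w)%g <= len z + (len w).*2)%N.
Proof.
rewrite conjgE; have := lenM n_gt1 w^-1%g (z * w)%g; have := lenM n_gt1 z w.
rewrite lenV // -addnn => h1 h2; apply: leq_trans h2 _; by rewrite addnA [leqRHS]addnC leq_add2l.
Qed.

Lemma len_conj_simple z i : (len (z ^ s i)%g <= (len z).+2)%N.
Proof. by have := len_conj z (s i); have := len_simple n_gt1 i; lia. Qed.

(** Conjugation by [y] turns [t i j] into [t (y i) (y j)]. The two commute because they move
    disjoint classes, so either one can be carried past [y] in place of the other. *)
Lemma conj_refl_other y i j : fpf_invol y -> (j != i %[mod n])%Z ->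
  (j != y i %[mod n])%Z -> (y ^ t i j = y ^ t (y i) (y j))%g.
Proof.
move=> fy ji jyi; have ij : (i != j %[mod n])%Z by rewrite eqmod_sym.
have yij : (y i != y j %[mod n])%Z by rewrite ap_mod.
have yji : (y j != i %[mod n])%Z by rewrite -(ap_mod y) fpfK.
have e : (y * t i j = t (y i) (y j) * y)%g by rewrite -(reflJ y ij) mulgVK.
have e1 : (t i j * y = y * t (y i) (y j))%g.
  by apply: invg_inj; rewrite !invgM !reflV // fpfV.
have e2 : (t i j * t (y i) (y j) = t (y i) (y j) * t i j)%g.
  have : (t (y i) (y j) * t i j * (t (y i) (y j))^-1 = t i j)%g.
    by rewrite reflJ // !reflO // eqmod_sym // fpf_neqmod.
  by rewrite reflV // => {1}<-; rewrite -mulgA reflK // mulg1.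
by rewrite !conjgE !reflV // e !mulgA e2 -!mulgA e1.
Qed.

(** * Conjugations by reflections that raise the length *)

Definition ordb e (a b : int) := if e then a < b else b < a.

(** The flag [e] treats [Pi_plus] ([true]) and [Pi_minus] ([false]) together. The rise in length is
    encoded by two order conditions, which can be followed through a conjugation. *)
Definition conj_up e y r z : Prop := exists j,
  [/\ ordb e r j, ordb e (y r) (y j), (j != r %[mod n])%Z, (j != y r %[mod n])%Z
    & z = (y ^ t r j)%g].

(** Right multiplication by [t i j] lengthens both [y] and [t i j * y]. The two increases add up
    because [y * t i j] and [t i j * y] are mutually inverse, hence of equal length. *)
Lemma len_conj_up_aux y i j : fpf_invol y -> (j != i %[mod n])%Z ->
  (j != y i %[mod n])%Z -> i < j -> y i < y j ->
  ((len y).+2 <= len (y ^ t i j)%g)%N.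
Proof.
move=> fy ji jyi ltij ltyij; have ij : (i != j %[mod n])%Z by rewrite eqmod_sym.
have yji : (y j != i %[mod n])%Z by rewrite -(ap_mod y) fpfK.
have l1 := len_refl_gt n_gt1 ij ltij ltyij.
have /(len_refl_gt n_gt1 ij ltij) : (t i j * y)%g i < (t i j * y)%g j.
  rewrite !affsym_mulE !reflO // ?fpf_neqmod //.
  by rewrite eqmod_sym.
rewrite -[X in (len X < _)%N]invgK lenV // invgM reflV // fpfV // conj_refl //.
exact: leq_ltn_trans.
Qed.

Lemma len_conj_up e y r z : fpf_invol y -> conj_up e y r z -> ((len y).+2 <= len z)%N.
Proof.
move=> fy [j [o1 o2 jr jyr ->]]; case: e o1 o2 => /= o1 o2.
  exact: len_conj_up_aux.
have yjr : (y j != r %[mod n])%Z by rewrite -(ap_mod y) fpfK.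
by rewrite reflC // 1?eqmod_sym //; apply: len_conj_up_aux; rewrite // 1?eqmod_sym.
Qed.

Lemma ordbP e (a b : int) : a != b -> ~~ ordb e a b -> ordb e b a.
Proof. by case: e => /=; lia. Qed.

(** If [y r] and [y j] were in the wrong order, the conjugate would have them in the right one, so
    [y] would arise from it by a raising conjugation and be longer. *)
Lemma conj_upI e y r j : fpf_invol y -> (j != r %[mod n])%Z ->
  (j != y r %[mod n])%Z -> ordb e r j -> (len y <= len (y ^ t r j)%g)%N ->
  conj_up e y r (y ^ t r j)%g.
Proof.
move=> fy jr jyr o le; exists j; split=> //.
have rj : (r != j %[mod n])%Z by rewrite eqmod_sym.
have yjr : (y j != r %[mod n])%Z by rewrite -(ap_mod y) fpfK.
apply: contraLR le => /ordbP o'; rewrite -ltnNge.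
have yrj : y r != y j by rewrite (inj_eq (@ap_inj _ y)); apply: contraNneq jr => ->.
have {}o' := o' yrj.
have zr : (y ^ t r j)%g r = y j.
  by rewrite -conj_refl // !affsym_mulE reflL0 // reflO // fpf_neqmod.
have zj : (y ^ t r j)%g j = y r.
  rewrite -conj_refl // !affsym_mulE reflR0 // reflO ?fpf_neqmod //.
  by rewrite eqmod_sym.
have fz := fpf_conj (t r j) fy.
have : conj_up e (y ^ t r j)%g r y.
  exists j; rewrite zr zj; split=> //; first by rewrite eqmod_sym fpf_neqmod.
  by rewrite -conjgM reflK // conjg1.
by move/(len_conj_up fz); lia.
Qed.

(** This lets [Pi_plus y (y p)] and [Pi_minus y p] share the base point [p]. *)
Lemma conj_up_other e y r z : fpf_invol y -> conj_up e y (y r) z <-> conj_up e y r z.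
Proof.
move=> fy; suff h q : conj_up e y q z -> conj_up e y (y q) z.
  by split=> /h //; rewrite fpfK.
case=> j [o1 o2 jq jyq ->]; exists (y j); rewrite fpfK //; split=> //.
- by rewrite fpfK.
- by rewrite ap_mod.
- by rewrite -(ap_mod y) !fpfK.
- exact: conj_refl_other.
Qed.

Lemma ordb_simple e i a b : (a != b %[mod n])%Z -> ordb e a b -> t a b != s i ->
  ordb e (s i a) (s i b).
Proof.
move=> ab o ne; apply: contraT => no; move/negP: ne; case.
case: e o no => /= o; rewrite -leNgt => o'.
  by rewrite (simple_flip_refl n_gt1 o o').
by rewrite reflC // (simple_flip_refl n_gt1 o o') // eqmod_sym.
Qed.

(** By [ordb_simple] an order is reversed only for a pair whose reflection is [s i]. For either of
    the pairs [r, j] and [y r, y j] this would mean that [z] is [y ^ s i]. *)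
Lemma conj_up_simple e y r z i : fpf_invol y -> conj_up e y r z ->
  z <> (y ^ s i)%g -> conj_up e (y ^ s i)%g (s i r) (z ^ s i)%g.
Proof.
move=> fy [j [o1 o2 jr jyr ->]] ne; have rj : (r != j %[mod n])%Z by rewrite eqmod_sym.
have yE q : (y ^ s i)%g (s i q) = s i (y q).
  by rewrite conj_simpleE !affsym_mulE simpleKK.
exists (s i j); rewrite !yE; split.
- by apply: ordb_simple => //; apply/eqP => e'; case: ne; rewrite e'.
- apply: ordb_simple => //; first by rewrite ap_mod.
  by apply/eqP => e'; case: ne; rewrite conj_refl_other // e'.
- by rewrite ap_mod.
- by rewrite ap_mod.
- rewrite -reflJ // simpleV // -2!conjgM; congr (_ ^ _)%g.
  by rewrite !mulgA simpleK // mul1g.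
Qed.

Definition cover_up e y r z := conj_up e y r z /\ len z = (len y).+2.

(** The lifting property. A raising conjugation adds at least 2 to the length and a simple one
    changes it by at most 2, which forces all the length equalities. *)
Lemma cover_up_simple e y r z i : fpf_invol y -> z <> y ->
  (len (z ^ s i)%g = (len z).+2 /\ cover_up e y r (z ^ s i)%g) <->
  ((len (y ^ s i)%g).+2 = len y /\ cover_up e (y ^ s i)%g (s i r) z).
Proof.
move=> fy zy; have fys := fpf_conj (s i) fy; split=> [] [l1 [c l2]].
  have := conj_up_simple (i := i) fy c; rewrite conj_simpleK => /(_ _)/wrap[].
    by move=> /(congr1 (fun v => v ^ s i)%g); rewrite !conj_simpleK.
  move=> c'; have := len_conj_up fys c'; have := len_conj_simple (y ^ s i)%g i.
  by rewrite conj_simpleK => *; split; first lia; split=> //; lia.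
have := conj_up_simple (i := i) fys c; rewrite conj_simpleK simpleKK // => /(_ zy) c'.
have := len_conj_up fy c'; have := len_conj_simple z i.
by move=> *; split; first lia; split=> //; lia.
Qed.

(** * Ascents, descents and weights *)

Lemma len_conj_asc y i : fpf_invol y -> y i < y (i + 1) ->
  len (y ^ s i)%g = (len y).+2.
Proof.
move=> fy asc; have l1 := len_asc n_gt1 asc.
have : (s i * y)%g i < (s i * y)%g (i + 1).
  (* Only [y i] congruent to [i] would let [s i] reverse the ascent. *)
  rewrite !affsym_mulE ltNge; apply/negP => /(simple_flip n_gt1 asc)[k [e _]].
  by have := fpf_neqmod i fy; rewrite e eqmodZ eqxx.
move/(len_asc n_gt1); rewrite -conj_simpleE => ->.
by rewrite -lenV // invgM fpfV // simpleV // l1.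
Qed.

Lemma len_conj_desc y i : fpf_invol y -> y (i + 1) < y i -> y i <> i + 1 ->
  [/\ len y = (len (y ^ s i)%g).+2 & (y ^ s i)%g i < (y ^ s i)%g (i + 1)].
Proof.
move=> fy desc ne; have fys := fpf_conj (s i) fy.
have asc : (y ^ s i)%g i < (y ^ s i)%g (i + 1).
  (* A reversal would give [y i = i + 1 + kn] and [y (i + 1) = i + kn]; being an involution, [y]
     then has [k = 0], the excluded case. *)
  rewrite conj_simpleE !affsym_mulE simpleL // simpleR // ltNge; apply/negP.
  move=> /(simple_flip n_gt1 desc)[k [e1 e2]].
  have := fpfK i fy; rewrite e2 apZ e1 => h; case: ne.
  by rewrite e2 (_ : k * n%:Z = 0) ?addr0 //; lia.
by split=> //; rewrite -(len_conj_asc fys asc) conj_simpleK.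
Qed.

Lemma conj_fixed y i : fpf_invol y -> y i = i + 1 -> (y ^ s i)%g = y.
Proof.
move=> fy e; have e' : y (i + 1) = i by rewrite -e fpfK.
have : (y * s i * y^-1 = s i)%g.
  by rewrite {1}/simple_refl reflJ ?succ_neqmod // e e' reflC // eqmod_sym succ_neqmod.
by rewrite conj_simpleE => {1}<-; rewrite -!mulgA mulKg simpleK // mulg1.
Qed.

Definition weight y p x : int := (x == p %[mod n])%Z%:R + (x == y p %[mod n])%Z%:R.

(** This is Phi. By [conj_up_other] the base point [p] serves on the plus side as well, in place of
    [y p]. *)
Definition signed_cover y p z : int :=
  `[< cover_up true y p z >]%:R - `[< cover_up false y p z >]%:R.

Lemma weight_fpf y p x : fpf_invol y -> weight y p (y x) = weight y p x.
Proof.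
move=> fy; rewrite /weight addrC ap_mod; congr (_ + _%:R).
by rewrite -(ap_mod y x) [in RHS](fpfK p fy).
Qed.

Lemma weight_conj y p x w : weight (y ^ w^-1)%g (w p) x = weight y p ((w^-1)%g x).
Proof.
rewrite /weight conjgE invgK !affsym_mulE apVK.
by rewrite -(ap_mod w ((w^-1)%g x)) -(ap_mod w _ (y p)) apKV.
Qed.

Lemma simple_near x i : x - 1 <= s i x <= x + 1.
Proof. by case: (simpleP n_gt1 i) => *; lia. Qed.

(* u is the end of {i, i + 1} that plays the role of r in t_{rj}. *)
Lemma cover_simple_asc e y p i (u := if e then i else i + 1)
    (v := if e then i + 1 else i) :
    fpf_invol y -> y i < y (i + 1) ->
  cover_up e y p (y ^ s i)%g <->
  ((u == p %[mod n])%Z || (u == y p %[mod n])%Z) &&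
  ~~ ((v == p %[mod n])%Z || (v == y p %[mod n])%Z).
Proof.
move=> fy asc; have uv : ordb e u v by rewrite /u /v; case: (e) => /=; lia.
have yuv : ordb e (y u) (y v) by rewrite /u /v; case: (e) => /=; lia.
have suv : s i = t u v.
  by rewrite /u /v; case: (e) => //; rewrite reflC // eqmod_sym succ_neqmod.
have su : s i u = v by rewrite /u /v; case: (e); rewrite ?simpleL ?simpleR.
have sv : s i v = u by rewrite /u /v; case: (e); rewrite ?simpleL ?simpleR.
have uvn : (u != v %[mod n])%Z.
  by rewrite /u /v; case: (e); last rewrite eqmod_sym; apply: succ_neqmod.
have so x : (x != u %[mod n])%Z -> (x != v %[mod n])%Z -> s i x = x.
  by rewrite suv; apply: reflO.
split=> [[[j [o1 o2 jp jyp E]] _]|/andP[up]]; last first.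
  rewrite negb_or => /andP[vp vyp]; split; last exact: len_conj_asc.
  suff h q : (u == q %[mod n])%Z -> (v != q %[mod n])%Z -> (v != y q %[mod n])%Z ->
      conj_up e y q (y ^ s i)%g.
    by case/orP: up => uq; last (apply/conj_up_other => //); apply: h; rewrite // fpfK.
  case/modeqP=> k e1 vq vyq; exists (v - k * n%:Z).
  have eq : q = u + (- k) * n%:Z by rewrite e1; ring.
  have ev : v - k * n%:Z = v + (- k) * n%:Z by ring.
  rewrite ev; split.
  - by rewrite eq; case: (e) uv => /=; rewrite ltrD2r.
  - by rewrite eq !apZ; case: (e) yuv => /=; rewrite ltrD2r.
  - by rewrite eqmodZ.
  - by rewrite eqmodZ.
  - by rewrite eq reflZ // suv.
have pj : (p != j %[mod n])%Z by rewrite eqmod_sym.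
have yjp : (y j != p %[mod n])%Z by rewrite -(ap_mod y) fpfK.
have ep : (y ^ s i)%g p = y j.
  by rewrite E -conj_refl // !affsym_mulE reflL0 // reflO // fpf_neqmod.
have eyp : (y ^ s i)%g (y p) = j.
  rewrite E -conj_refl // !affsym_mulE (reflO (x := y p) pj) ?fpf_neqmod //.
    by rewrite fpfK // reflL0.
  by rewrite eqmod_sym.
have gt x : x = p \/ x = y p -> ordb e (y x) ((y ^ s i)%g x).
  by case=> ->; rewrite ?ep ?eyp ?fpfK.
(* The conjugate sends [v] to [s i (y u)], which is within 1 of [y u] and so not beyond [y v]; this
   contradicts [gt] for [x] in the class of [v]. *)
have h x : x = p \/ x = y p -> (v != x %[mod n])%Z.
  move=> /gt; apply: contraTN; rewrite eqmod_sym => /modeqP[k ->].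
  rewrite conj_simpleE !affsym_mulE !apZ sv.
  move: yuv (simple_near (y u) i); rewrite /ordb.
  move: (s i (y u)) (y u) (y v) (k * n%:Z) => A B C D.
  by case: (e); clear; lia.
rewrite (negbTE (h p (or_introl erefl))) (negbTE (h _ (or_intror erefl))) /= andbT.
apply: contraT; rewrite negb_or => /andP[up uyp].
(* If [u] also avoids both classes, [s i] fixes [p] and [y p], so the value at [p] does not move,
   against [gt]. *)
have := gt p (or_introl erefl).
have sp : s i p = p by apply: so; rewrite eqmod_sym; [exact: up|apply: h; left].
have syp : s i (y p) = y p by apply: so; rewrite eqmod_sym; [exact: uyp|apply: h; right].
by rewrite conj_simpleE !affsym_mulE sp syp /ordb ltxx; case: (e).
Qed.

(** Both weights are 0 or 1, as [p] and [y p] are incongruent. The plus cover occurs exactly for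
    weights 1 at [i] and 0 at [i + 1], the minus cover for the reverse. *)
Lemma signed_cover_asc y p i : fpf_invol y -> y i < y (i + 1) ->
  signed_cover y p (y ^ s i)%g = weight y p i - weight y p (i + 1).
Proof.
move=> fy asc; have yp := fpf_neqmod p fy.
have ne a : ~~ ((a == p %[mod n])%Z && (a == y p %[mod n])%Z).
  by apply: contra yp => /andP[/eqP <- /eqP <-].
rewrite /signed_cover /weight.
have -> : `[< cover_up true y p (y ^ s i)%g >] = _ :=
  asbool_equiv_eq (cover_simple_asc true p fy asc).
have -> : `[< cover_up false y p (y ^ s i)%g >] = _ :=
  asbool_equiv_eq (cover_simple_asc false p fy asc).
rewrite !asboolb; have := ne i; have := ne (i + 1).
by do 4 case: (_ == _).
Qed.

(** The Leibniz rule for one letter. Away from [z = y] it is the lifting property; at [z = y] the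
    position of [y i] relative to [y (i + 1)] decides. *)
Lemma signed_cover_simple y z p i : fpf_invol y -> fpf_invol z ->
  (len (z ^ s i)%g == (len z).+2)%:R * signed_cover y p (z ^ s i)%g =
  ((len (y ^ s i)%g).+2 == len y)%:R * signed_cover (y ^ s i)%g (s i p) z
  + (z == y)%:R * (weight y p i - weight y p (i + 1)).
Proof.
move=> fy fz; have fys := fpf_conj (s i) fy.
have [->|/eqP zy] := eqVneq z y; last first.
  rewrite mul0r addr0 /signed_cover !mulrBr -!natrM !mulnb.
  have h e : (len (z ^ s i)%g == (len z).+2) && `[< cover_up e y p (z ^ s i)%g >]
             = ((len (y ^ s i)%g).+2 == len y) && `[< cover_up e (y ^ s i)%g (s i p) z >].
    apply/idP/idP=> /andP[/eqP l /asboolP c];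
      have [h1 h2] := cover_up_simple e p i fy zy;
      by [have [/eqP -> /asboolP ->] := h1 (conj l c)
         |have [/eqP -> /asboolP ->] := h2 (conj l c)].
  by rewrite !h.
rewrite mul1r; case: (ltrgtP (y i) (y (i + 1))) => [asc|desc|/ap_inj]; last by lia.
  rewrite len_conj_asc // eqxx mul1r signed_cover_asc //.
  by rewrite (_ : (_ == _) = false) ?mul0r ?add0r //; lia.
(* Here [s i] commutes with [y]: no length changes, and the weights at [i] and [i + 1 = y i]
   agree. *)
have [e|/eqP ne] := eqVneq (y i) (i + 1).
  have := weight_fpf p i fy; rewrite conj_fixed // e => ->; rewrite subrr addr0.
  by rewrite (gtn_eqF (leqnSn _)) (ltn_eqF (leqnSn _)) !mul0r.
(* Below a descent the ascent formula applies to [y ^ s i]; transporting weights by [s i] swaps [i]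
   and [i + 1], so the correction cancels it. *)
have [l asc] := len_conj_desc fy desc ne.
rewrite -l eqxx mul1r (_ : (_ == _) = false) ?mul0r; last by lia.
have := signed_cover_asc (s i p) fys asc; rewrite conj_simpleK => ->.
have := weight_conj y p _ (s i); rewrite simpleV // => h.
by rewrite !h simpleL // simpleR //; ring.
Qed.

Lemma weight_periodic y p x k : weight y p (x + k * n%:Z) = weight y p x.
Proof. by rewrite /weight !eqmodZ. Qed.

End FixedPointFree.

(** * The transition identity along a word *)

Section WordTransition.
Variable n : nat.
Hypothesis n_gt1 : (1 < n)%N.
Implicit Types (w y z : affsym n) (i j p x : int) (a : seq int).
Local Notation s := (simple_refl n).
Local Notation word := (word n).

Lemma len_conj_word z a : (len (z ^ word a)%g <= len z + (size a).*2)%N.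
Proof.
by rewrite (leq_trans (len_conj n_gt1 _ _)) // leq_add2l leq_double len_word.
Qed.

Lemma conj_eq_inv z y w : ((z ^ w)%g == y) = (z == (y ^ w^-1)%g).
Proof.
apply/eqP/eqP => [<-|->]; first by rewrite -conjgM mulgV conjg1.
by rewrite -conjgM mulVg conjg1.
Qed.

(* Each letter of the word acts by [signed_cover_simple]; the j-th summand is
   the correction picked up by deleting the j-th letter. *)
Lemma signed_cover_word a y z p : fpf_invol y -> fpf_invol z ->
  (len (z ^ word a)%g == (len z + (size a).*2)%N)%:R * signed_cover y p (z ^ word a)%g
  = ((len (y ^ (word a)^-1)%g + (size a).*2)%N == len y)%:R
      * signed_cover (y ^ (word a)^-1)%g (word a p) z
  + \sum_(j < size a)
      ((z ^ word (take j a ++ drop j.+1 a))%g == y)%:R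
      * (len y == (len z + (size a).-1.*2)%N)%:R
      * (weight y p (((word (drop j.+1 a))^-1)%g a`_j)
         - weight y p (((word (drop j.+1 a))^-1)%g (a`_j + 1))).
Proof.
elim: a z => [|i a IH] z fy fz.
  by rewrite big_ord0 addr0 word_nil invg1 !conjg1 -[(size _).*2]/0%N !addn0 !eqxx.
set w := word a; pose z1 := (z ^ s i)%g; pose y1 := (y ^ w^-1)%g.
have fy1 : fpf_invol y1 by apply: fpf_conj.
have fz1 : fpf_invol z1 by apply: fpf_conj.
(* Each letter adds at most 2, so the maximal rise along the word is reached only if it is reached
   at the first letter and along the rest. [down] is the same fact on the side of [y]. *)
have up b :
    (len (z1 ^ word b)%g == (len z + (size b).+1.*2)%N) =
    (len z1 == (len z).+2) && (len (z1 ^ word b)%g == (len z1 + (size b).*2)%N).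
  have := len_conj_word z1 b; have := len_conj_simple n_gt1 z i.
  rewrite -/z1 doubleS => h1 h2; apply/eqP/andP => [e|[/eqP e1 /eqP e2]];
     [split; apply/eqP; lia|lia].
have down : ((len (y1 ^ s i)%g + (size a).+1.*2)%N == len y) =
    ((len (y1 ^ s i)%g).+2 == len y1) && ((len y1 + (size a).*2)%N == len y).
  have := len_conj_word y1 a; rewrite -conjgM mulVg conjg1 -/w.
  have := len_conj_simple n_gt1 (y1 ^ s i)%g i; rewrite conj_simpleK //.
  by rewrite doubleS => h1 h2; apply/eqP/andP => [e|[/eqP e1 /eqP e2]];
     [split; apply/eqP; lia|lia].
rewrite word_cons -/w conjgM -/z1 [size (i :: a)]/= up // -/w -mulnb natrM -mulrA.
rewrite IH // mulrDr -/w -/y1 invgM simpleV // conjgM -/y1 down affsym_mulE.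
rewrite big_ord_recl; set t0 := (X in _ = _ + (X + _)).
have -> : t0 = ((z ^ w)%g == y)%:R * (len y == (len z + (size a).*2)%N)%:R *
    (weight y p ((w^-1)%g i) - weight y p ((w^-1)%g (i + 1))).
  by rewrite /t0 /= drop0.
rewrite addrA; congr (_ + _); last first.
  rewrite mulr_sumr; apply: eq_bigr => j _; rewrite /= word_cons conjgM -/z1.
  rewrite !mulrA; congr (_ * _); rewrite -!natrM !mulnb; congr (_%:R).
  congr nat_of_bool; set b := take j a ++ _; have aj := ltn_ord j.
  have sb : (size b).+1 = size a by rewrite size_cat size_take size_drop aj; lia.
  have E := up b; rewrite -sb /= in E *.
  have [yE|_] := eqVneq (z1 ^ word b)%g y; last by rewrite andbF.
  by rewrite -yE E andbT.
(* The one-letter rule at base [y1] yields the main term, and its correction is the summand for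
   deleting the first letter. *)
rewrite mulrCA (signed_cover_simple n_gt1 _ _ fy1 fz) mulrDr mulrA.
congr (_ * _ + _); first by rewrite -natrM mulnb andbC.
rewrite !weight_conj mulrA; congr (_ * _).
rewrite conj_eq_inv -/y1.
have [->|_] := eqVneq z y1; rewrite ?mulr0 ?mul0r // mulr1 ?mul1r.
by rewrite eq_sym.
Qed.

End WordTransition.

(** * Cyclically decreasing elements *)

Section CyclicallyDecreasing.
Variable n : nat.
Hypothesis n_gt1 : (1 < n)%N.
Implicit Types (w : affsym n) (i j g u v x : int) (a b : seq int).
Implicit Types (I J : {set 'I_n}).
Local Notation s := (simple_refl n).
Local Notation full := (finset.setTfor 'I_n).
Local Notation word := (word n).

Fact residue_subproof x : (`|(x %% n)%Z| < n)%N.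
Proof. by rewrite -ltz_nat gez0_abs ?modz_ge0 ?ltz_pmod ?n_neq0 //; lia. Qed.
Definition residue x : 'I_n := Ordinal (residue_subproof x).

Lemma residue_eq x u : (residue x == residue u) = (x == u %[mod n])%Z.
Proof.
apply/eqP/eqP => [/(congr1 (fun k : 'I_n => (k : nat)%:Z))|e]; last first.
  by apply: val_inj; rewrite /= e.
by rewrite /= !gez0_abs ?modz_ge0 ?n_neq0.
Qed.

Lemma residue_ord (k : 'I_n) : residue k%:Z = k.
Proof. by apply: val_inj; rewrite /= modz_nat absz_nat modn_small. Qed.

Lemma neqmod_small x u : 0 < x - u -> x - u < n%:Z -> (x != u %[mod n])%Z.
Proof.
move=> h1 h2; apply/negP => /modeqP[k e].
have [k_gt0|k_le0] := ltrP 0 k.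
  by have : n%:Z <= k * n%:Z by [rewrite ler_peMl]; lia.
by have : k * n%:Z <= 0 by [rewrite mulr_le0_ge0]; lia.
Qed.

(** Cutting the circle Z/n at [g]: one representative of every other class, in decreasing order. *)
Definition window g := [seq g - k.+1%:Z | k <- iota 0 n.-1].

Lemma mem_window g x : (x \in window g) = (g - n%:Z < x < g).
Proof.
apply/mapP/andP => [[k]|[h1 h2]].
  by rewrite mem_iota add0n => /andP[_ k_lt] ->; split; lia.
by exists (absz (g - x - 1)%R); [rewrite mem_iota; lia|lia].
Qed.

Lemma window_sorted g : sorted (fun x u => u < x) (window g).
Proof.
rewrite sorted_map; apply: (@sub_sorted _ ltn); last exact: iota_ltn_sorted.
by move=> k l /=; lia.
Qed.

Definition decreasing_word g I := [seq x <- window g | residue x \in I].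

Definition residues a : {set 'I_n} := [set k in map residue a].

(** The cyclically decreasing condition together with distinctness of the residues, which
    [reduced_cyc_dec_word] derives from reducedness. *)
Fixpoint cyc_dec_word a :=
  if a is x :: b then
    [&& residue x \notin residues b, residue (x + 1) \notin residues b
      & cyc_dec_word b]
  else true.

Lemma mem_residues a x : x \in a -> residue x \in residues a.
Proof. by move=> xa; rewrite inE map_f. Qed.

Lemma residues_cons x a : residues (x :: a) = residue x |: residues a.
Proof. by apply/setP => k; rewrite !inE. Qed.

Lemma cyc_dec_word_window g a : sorted (fun x u => u < x) a ->
  {subset a <= window g} -> cyc_dec_word a.
Proof.
have tr : transitive (fun x u : int => u < x) by move=> x u v /=; lia.
elim: a => //= x a IH; rewrite (path_sortedE tr) => /andP[/allP lt_x srt] sub.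
have subw u : u \in x :: a -> g - n%:Z < u < g by move/sub; rewrite mem_window.
have xw := subw x (mem_head _ _).
apply/and3P; split; last by apply: IH => // u ua; apply: sub; rewrite inE ua orbT.
- rewrite inE; apply/mapP => -[u ua /eqP]; rewrite residue_eq; apply/negP.
  have /= := lt_x _ ua; have := subw u; rewrite inE ua orbT => /(_ erefl) uw h.
  by apply: neqmod_small; lia.
- rewrite inE; apply/mapP => -[u ua /eqP]; rewrite residue_eq; apply/negP.
  have /= := lt_x _ ua; have := subw u; rewrite inE ua orbT => /(_ erefl) uw h.
  by apply: neqmod_small; lia.
Qed.

Lemma cyc_dec_decreasing_word g I : cyc_dec_word (decreasing_word g I).
Proof.
apply: (@cyc_dec_word_window g); last by move=> x; rewrite mem_filter => /andP[].
apply: sorted_filter (window_sorted g); by move=> x u v /=; lia.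
Qed.

Lemma cyc_dec_word_uniq a : cyc_dec_word a -> uniq (map residue a).
Proof. by elim: a => //= x a IH /and3P[+ _ /IH ->]; rewrite inE => ->. Qed.

Lemma window_rep g x : residue x != residue g ->
  exists2 u, residue u = residue x & u \in window g.
Proof.
rewrite residue_eq => xg; exists (g - n%:Z + ((x - g) %% n)%Z).
  apply/eqP; rewrite residue_eq; apply/modeqP; exists (- 1 - ((x - g) %/ n)%Z).
  by have := divz_eq (x - g) n; lia.
have : ((x - g) %% n)%Z != 0.
  by apply: contraNneq xg => h; rewrite eqz_mod_dvd; apply/dvdz_mod0P.
have := modz_ge0 (x - g) (n_neq0 n_gt1); have := @ltz_pmod (x - g) n.
by rewrite mem_window; lia.
Qed.

Lemma residues_decreasing_word g I : residue g \notin I ->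
  residues (decreasing_word g I) = I.
Proof.
move=> gI; apply/setP => k; rewrite inE; apply/mapP/idP => [[x]|kI].
  by rewrite mem_filter => /andP[xI _] ->.
have [|x xk xw] := @window_rep g k%:Z.
  by rewrite residue_ord; apply: contraNneq gI => <-.
by exists x; rewrite ?mem_filter xk residue_ord // kI.
Qed.

Lemma size_cyc_dec_word a : cyc_dec_word a -> size a = #|residues a|.
Proof.
move/cyc_dec_word_uniq => ua; rewrite -(size_map residue) -(card_uniqP ua).
by apply: eq_card => k; rewrite inE.
Qed.

Lemma size_decreasing_word g I : residue g \notin I ->
  size (decreasing_word g I) = #|I|.
Proof.
by move=> gI; rewrite size_cyc_dec_word ?cyc_dec_decreasing_word // residues_decreasing_word.
Qed.

Lemma decreasing_word_split g x J : x \in window g -> residue x \notin J ->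
  exists U V, [/\ decreasing_word g J = U ++ V,
    decreasing_word g (residue x |: J) = U ++ x :: V,
    {in U, forall u, x < u < g /\ residue u \in J}
    & {in V, forall v, g - n%:Z < v < x}].
Proof.
move=> xw xJ; have [U [V E]] : exists U V, window g = U ++ x :: V.
  by case/splitPr: xw => U V; exists U, V.
have srt := window_sorted g; rewrite E in srt.
have tr : transitive (fun x u : int => u < x) by move=> y u v /=; lia.
have mw u : (u \in U ++ x :: V) -> g - n%:Z < u < g by rewrite -E mem_window.
have ltU u : u \in U -> x < u.
  move=> uU; move: srt; rewrite (sorted_pairwise tr) pairwise_cat.
  by case/and3P => /allrelP h _ _; apply: h => //; rewrite mem_head.
have ltV v : v \in V -> v < x.
  move=> vV; have := srt; rewrite (sorted_pairwise tr) pairwise_cat.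
  by case/and3P => _ _ /= /andP[/allP h _]; apply: h.
have nU u : u \in U -> residue u != residue x.
  move=> uU; rewrite residue_eq; apply: neqmod_small; have := ltU u uU; first lia.
  by have := mw u; rewrite mem_cat uU => /(_ erefl);
    move: (mw x); rewrite mem_cat mem_head orbT => /(_ erefl); lia.
have nV v : v \in V -> residue v != residue x.
  move=> vV; rewrite residue_eq eqmod_sym; apply: neqmod_small; have := ltV v vV; first lia.
  by have := mw v; rewrite mem_cat inE vV !orbT => /(_ erefl);
    move: (mw x); rewrite mem_cat mem_head orbT => /(_ erefl); lia.
exists [seq u <- U | residue u \in J], [seq v <- V | residue v \in J].
rewrite /decreasing_word E !filter_cat /= (negbTE xJ) setU11; split=> //.
- congr (_ ++ _ :: _); apply: eq_in_filter => u uW; rewrite in_setU1.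
    by rewrite (negbTE (nU u uW)).
  by rewrite (negbTE (nV u uW)).
- move=> u; rewrite mem_filter => /andP[uJ uU]; split=> //; rewrite ltU //=.
  by have := mw u; rewrite mem_cat uU => /(_ erefl) /andP[].
- move=> v; rewrite mem_filter => /andP[_ vV]; rewrite ltV // andbT.
  by have := mw v; rewrite mem_cat inE vV !orbT => /(_ erefl) /andP[].
Qed.

Lemma word_commute i b : (forall u, u \in b -> (s i * s u = s u * s i)%g) ->
  (s i * word b = word b * s i)%g.
Proof.
elim: b => [|u b IH] h; first by rewrite word_nil mulg1 mul1g.
rewrite word_cons mulgA h ?mem_head // -!mulgA IH // => v vb.
by apply: h; rewrite inE vb orbT.
Qed.

(** Insertion sort: the first letter commutes past every larger letter [v] of the window, since [v]
    avoids its successor by hypothesis and the window is too short for [v + 1] to wrap around to it.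
    So the product depends only on the set of residues. *)
Lemma word_cyc_dec g a : cyc_dec_word a -> residue g \notin residues a ->
  word a = word (decreasing_word g (residues a)).
Proof.
elim: a => [|x a IH] /=.
  move=> _ _; congr Defs.word; apply/esym/eqP; rewrite -size_eq0.
  by rewrite size_decreasing_word ?inE // cards_eq0; apply/eqP/setP => k; rewrite !inE.
case/and3P => xa x1a cda; rewrite residues_cons in_setU1 negb_or => /andP[gx ga].
have [|u ux uw] := @window_rep g x; first by rewrite eq_sym.
have ua : residue u \notin residues a by rewrite ux.
have [U [V [E1 E2 hU hV]]] := decreasing_word_split uw ua.
rewrite -ux E2 word_cons IH // E1 !word_cat word_cons !mulgA; congr (_ * _)%g.
have /eqP := ux; rewrite residue_eq => /(simple_mod n_gt1) <-.
apply: word_commute => v vU; have [/andP[uv vg] vI] := hU v vU.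
apply: simple_comm => //.
- by rewrite -residue_eq; apply: contraNneq ua => ->.
- rewrite -residue_eq; apply: contraNneq x1a => e.
  rewrite (_ : residue (x + 1) = residue v) //; rewrite -e; apply/eqP.
  by move/eqP: ux; rewrite !residue_eq eqmod_sym !eqz_mod_dvd opprD addrACA subrr addr0.
- move: uw; rewrite mem_window eqmod_sym => uw.
  by apply: neqmod_small; move: uw uv vg; clear; lia.
Qed.

(** A place to cut the circle; the default 0 is reached only for the full set. *)
Definition gap I : int := if [pick k | k \notin I] is Some k then (k : nat)%:Z else 0.

(** The element d_I; by [cyc_eltE] any other cut outside [I] gives the same element. *)
Definition cyc_elt I : affsym n := word (decreasing_word (gap I) I).

Lemma gapP I : I != full -> residue (gap I) \notin I.
Proof.
move=> IT; rewrite /gap; case: pickP => [k kI|all]; first by rewrite residue_ord.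
by case/eqP: IT; apply/setP => k; rewrite inE; have := all k => /negbFE.
Qed.

Lemma notin_neq_full I (k : 'I_n) : k \notin I -> I != full.
Proof. by apply: contraNneq => ->; rewrite finset.in_setT. Qed.

Lemma cyc_eltE g I : residue g \notin I -> word (decreasing_word g I) = cyc_elt I.
Proof.
move=> gI; have gI' := gapP (notin_neq_full gI).
have := @word_cyc_dec (gap I) _ (cyc_dec_decreasing_word g I).
by rewrite residues_decreasing_word // => ->.
Qed.

(** Only a letter congruent to [i] can carry a value across the wall between [i] and [i + 1]. *)
Lemma word_gt a i x : residue i \notin residues a -> i < x -> i < word a x.
Proof.
elim: a => [|u a IH]; first by rewrite word_nil.
rewrite residues_cons in_setU1 negb_or residue_eq => /andP[iu ia] /(IH ia).
rewrite word_cons affsym_mulE; move: (word a x) => c.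
case: (simpleP n_gt1 u) => [k _|k e|//]; first by lia.
move=> h; have : c - 1 != i; last by lia.
by apply: contraNneq iu => <-; apply/modeqP; exists k; rewrite e; ring.
Qed.

Lemma word_le a i x : residue i \notin residues a -> x <= i -> word a x <= i.
Proof.
elim: a => [|u a IH]; first by rewrite word_nil.
rewrite residues_cons in_setU1 negb_or residue_eq => /andP[iu ia] /(IH ia).
rewrite word_cons affsym_mulE; move: (word a x) => c.
case: (simpleP n_gt1 u) => [k e|k _|//]; last by lia.
move=> h; have : c != i; last by lia.
by apply: contraNneq iu => <-; apply/modeqP; exists k.
Qed.

Lemma word_fix a x : (forall u, u \in a -> (x != u %[mod n])%Z) ->
  (forall u, u \in a -> (x != u + 1 %[mod n])%Z) -> word a x = x.
Proof.
elim: a => [|u a IH] h1 h2; first by rewrite word_nil.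
rewrite word_cons affsym_mulE IH => [|v va|v va].
- by apply: simpleO => //; [apply: h1|apply: h2]; rewrite mem_head.
- by apply: h1; rewrite inE va orbT.
- by apply: h2; rewrite inE va orbT.
Qed.

Lemma residues_rev a : residues (rev a) = residues a.
Proof. by apply/setP => k; rewrite !inE map_rev mem_rev. Qed.

(** The other letters do not cross the wall between [x] and [x + 1], so prepending [x] always meets
    an ascent of the inverse. *)
Lemma len_uniq_word a : uniq (map residue a) -> len (word a) = size a.
Proof.
elim: a => [|x a IH] /=; first by rewrite word_nil len1.
case/andP => xa /IH <-; rewrite word_cons -(lenV n_gt1 (word a)).
rewrite -(lenV n_gt1) invgM simpleV // len_asc // -word_rev //.
have xr : residue x \notin residues (rev a) by rewrite residues_rev inE.
by apply: le_lt_trans (word_le xr (lexx _)) (word_gt xr _); lia.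
Qed.

Lemma len_cyc_elt I : I != full -> len (cyc_elt I) = #|I|.
Proof.
move=> IT; rewrite len_uniq_word ?size_decreasing_word ?gapP //.
exact/cyc_dec_word_uniq/cyc_dec_decreasing_word.
Qed.

Lemma cyc_elt_in I i : I != full -> residue i \in I -> cyc_elt I (i + 1) = i.
Proof.
move=> IT iI; have gI := gapP IT; set g := gap I in gI.
have [|x xi xw] := @window_rep g i; first by apply: contraNneq gI => <-.
suff h : cyc_elt I (x + 1) = x.
  have /eqP := xi; rewrite residue_eq eqmod_sym => /modeqP[k ->].
  by rewrite addrAC apZ h.
have xJ : residue x \notin I :\ residue x by rewrite !inE eqxx.
have [U [V [_ E hU hV]]] := decreasing_word_split xw xJ.
move: E; rewrite finset.setD1K ?xi // => E.
rewrite /cyc_elt -/g E word_cat word_cons !affsym_mulE.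
move: xw; rewrite mem_window => xw.
(* The smaller letters [V] act first and fix [x + 1]; then [x] lowers it to [x], which the larger
   letters [U] fix. *)
rewrite (_ : word V _ = x + 1) ?simpleR //.
  apply: word_fix => u /hU[uu _]; rewrite eqmod_sym; apply: neqmod_small; lia.
by apply: word_fix => v /hV vv; apply: neqmod_small; lia.
Qed.

Lemma cyc_elt_eq I i : I != full -> (cyc_elt I (i + 1) == i) = (residue i \in I).
Proof.
move=> IT; apply/eqP/idP => [e|]; last exact: cyc_elt_in.
apply: contraT => iI; have := @word_gt (decreasing_word (gap I) I) i (i + 1).
rewrite residues_decreasing_word ?gapP // -/(cyc_elt I) e ltrDl ltr01 ltxx.
by move=> /(_ iI isT).
Qed.

Lemma cyc_elt_inj I J : I != full -> J != full -> cyc_elt I = cyc_elt J -> I = J.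
Proof.
move=> IT JT e; apply/setP => k; rewrite -(residue_ord k) -!cyc_elt_eq // e.
by [].
Qed.

End CyclicallyDecreasing.

(** * Deleting a letter of a cyclically decreasing word *)

Section DecreasingSums.
Variable n : nat.
Hypothesis n_gt1 : (1 < n)%N.
Implicit Types (w : affsym n) (i j g u v x : int) (a b : seq int).
Implicit Types (I J : {set 'I_n}).
Local Notation s := (simple_refl n).
Local Notation word := (word n).
Local Notation full := (finset.setTfor 'I_n).
Local Notation residue := (residue n_gt1).
Local Notation cyc_elt := (cyc_elt n_gt1).
Local Notation decreasing_word := (decreasing_word n_gt1).

(* Removing the letter x of a decreasing word U x V conjugates s_x by V; both
   ends of the resulting reflection are read off the shorter product U V. *)
Lemma decreasing_word_delete I a k : I != full -> a = decreasing_word (gap I) I ->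
    (k < size a)%N -> let J := I :\ residue a`_k in
  word (take k a ++ drop k.+1 a) = cyc_elt J /\
  (((word (drop k.+1 a))^-1)%g a`_k = ((cyc_elt J)^-1)%g a`_k /\
   ((word (drop k.+1 a))^-1)%g (a`_k + 1) = a`_k + 1).
Proof.
move=> IT ea ka J; have gI := gapP n_gt1 IT; set g := gap I in ea gI.
set x := a`_k in J *; have xa : x \in a by rewrite mem_nth.
have [xI xw] : residue x \in I /\ x \in window n g.
  by move: xa; rewrite ea mem_filter => /andP.
have xJ : residue x \notin J by rewrite !inE eqxx.
have [U [V [EJ E hU hV]]] := decreasing_word_split xw xJ.
rewrite finset.setD1K // -ea in E.
have kU : k = size U.
  have ua : uniq a.
    by apply: (@map_uniq _ _ residue); rewrite ea; exact/cyc_dec_word_uniq/cyc_dec_decreasing_word.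
  rewrite -(index_uniq 0 ka ua) -/x E index_cat /= eqxx addn0 ifN //.
  by apply/negP => /hU []; rewrite ltxx.
have -> : take k a = U by rewrite E kU take_size_cat.
have -> : drop k.+1 a = V by rewrite E -cat_rcons kU -(size_rcons U x) drop_size_cat.
have gJ : residue g \notin J by apply: contra gI; rewrite !inE => /andP[].
have wJ : word (U ++ V) = cyc_elt J by rewrite -EJ cyc_eltE.
move: xw; rewrite (mem_window n_gt1) => xw; split=> //; split; last first.
  rewrite -[X in _ = X](apVK (word V)); congr (_ _); symmetry.
  by apply: (word_fix n_gt1) => // v /hV vv; apply: (neqmod_small n_gt1); move: vv xw; clear; lia.
rewrite -wJ word_cat invgM affsym_mulE; congr (_ _).
rewrite -[LHS](apVK (word U)); congr (_ _).
apply: (word_fix n_gt1) => // u /hU[uu _]; rewrite eqmod_sym;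
  by apply: (neqmod_small n_gt1); move: uu xw; clear; lia.
Qed.

Section Periodic.
Variable c : int -> int.
Hypothesis c_periodic : forall x k, c (x + k * n%:Z) = c x.

Lemma periodic_mod (c' : int -> int) x u :
  (forall x k, c' (x + k * n%:Z) = c' x) -> (x == u %[mod n])%Z -> c' x = c' u.
Proof. by move=> h /modeqP[k ->]. Qed.

(* Every i in J satisfies d_J (i + 1) = i, so only the sum over the complement is
   left of the difference between two sums over a full period. *)
Lemma sum_cyc_elt J : J != full ->
  \sum_(i : 'I_n | i \notin J) (c (((cyc_elt J)^-1)%g (i : nat)%:Z) - c ((i : nat)%:Z + 1)) = 0.
Proof.
move=> JT; set d := ((cyc_elt J)^-1)%g.
have eJ (i : 'I_n) : i \in J -> d (i : nat)%:Z = (i : nat)%:Z + 1.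
  move=> iJ; rewrite -[X in d X](@cyc_elt_in _ n_gt1 J) ?apVK ?residue_ord //.
(* Over a full period both terms run once through all classes. *)
have : \sum_(i : 'I_n) (c (d (i : nat)%:Z) - c ((i : nat)%:Z + 1)) = 0.
  rewrite sumrB; apply/eqP; rewrite subr_eq0; apply/eqP.
  have := @sum_reindex n (fun x => d (x - 1)) c.
  rewrite !big_add1 !big_mkord => h; rewrite -[RHS]/(\sum_(i < n) c ((i : nat)%:Z + 1)).
  transitivity (\sum_(i < n) c (i.+1)%:Z); last first.
    by apply: eq_bigr => i _; rewrite -addn1 PoszD.
  rewrite -h.
  - by apply: eq_bigr => i _; rewrite -addn1 PoszD addrK.
  - by move=> x u /ap_inj /addIr.
  - by move=> x; rewrite addrAC; have := apZ d (x - 1) 1; rewrite mul1r.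
  - by move=> x; have := c_periodic x 1; rewrite mul1r.
rewrite (bigID (fun i : 'I_n => i \in J)) big1 => [|i /eJ ->]; last exact: subrr.
by rewrite Monoid.mul1m.
Qed.

(** Passes from positions in the word to elements of [I]. In the application [c] is the weight and
    [G] the indicator factor of [signed_cover_word]. *)
Lemma sum_delete (G : affsym n -> int) I a : I != full ->
    a = decreasing_word (gap I) I ->
  \sum_(k < size a) G (word (take k a ++ drop k.+1 a)) *
     (c (((word (drop k.+1 a))^-1)%g a`_k) - c (((word (drop k.+1 a))^-1)%g (a`_k + 1)))
  = \sum_(i in I) G (cyc_elt (I :\ i)) *
     (c (((cyc_elt (I :\ i))^-1)%g (i : nat)%:Z) - c ((i : nat)%:Z + 1)).
Proof.
move=> IT ea; pose T (i : 'I_n) := G (cyc_elt (I :\ i)) *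
     (c (((cyc_elt (I :\ i))^-1)%g (i : nat)%:Z) - c ((i : nat)%:Z + 1)).
transitivity (\sum_(k < size a) T (residue a`_k)).
  apply: eq_bigr => k _; have [-> [-> ->]] := decreasing_word_delete IT ea (ltn_ord k).
  rewrite /T; congr (_ * (_ - _)).
    apply: (periodic_mod (c' := fun x => c (((cyc_elt _)^-1)%g x))).
      by move=> x l; rewrite apZ c_periodic.
    by rewrite -residue_eq residue_ord.
  apply: (periodic_mod (c' := fun x => c (x + 1))).
    by move=> x l; rewrite addrAC c_periodic.
  by rewrite -residue_eq residue_ord.
rewrite -(big_mkord xpredT (fun k => T (residue a`_k))).
rewrite -(big_nth 0 xpredT (fun x => T (residue x))).
rewrite -(big_map residue xpredT T).
transitivity (\sum_(i <- enum I) T i); last by rewrite big_enum.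
apply: perm_big; apply: uniq_perm.
- by rewrite ea; exact/cyc_dec_word_uniq/cyc_dec_decreasing_word.
- exact: enum_uniq.
move=> i; rewrite mem_enum -[in RHS](residues_decreasing_word (gapP n_gt1 IT)) -ea.
by rewrite inE.
Qed.

(** Exchange pairs with [i] in [I] for pairs with [i] outside [J = I :\ i]. For fixed [J] the factor
    [G] is constant and [sum_cyc_elt] applies. *)
Lemma sum_delete_all (G : affsym n -> int) k :
  \sum_(I : {set 'I_n} | (#|I| == k) && (I != full))
     \sum_(i in I) G (cyc_elt (I :\ i)) *
       (c (((cyc_elt (I :\ i))^-1)%g (i : nat)%:Z) - c ((i : nat)%:Z + 1)) = 0.
Proof.
have [le_nk|lt_kn] := leqP n k.
  rewrite big1 // => I /andP[/eqP cI]; case/negP.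
  by rewrite eqEcard finset.subsetT cardsT card_ord cI.
have fullE I : (#|I| == k) && (I != full) = (#|I| == k).
  apply: andb_idr => /eqP cI; apply: contraTneq lt_kn => IT.
  by rewrite -cI IT cardsT card_ord ltnn.
rewrite (eq_bigl _ _ fullE) (exchange_big_dep xpredT) //=.
transitivity (\sum_(i : 'I_n) \sum_(J : {set 'I_n} | (#|J|.+1 == k) && (i \notin J))
    G (cyc_elt J) * (c (((cyc_elt J)^-1)%g (i : nat)%:Z) - c ((i : nat)%:Z + 1))).
  apply: eq_bigr => i _.
  rewrite (reindex_onto (fun J => i |: J) (fun I => I :\ i)) /=; last first.
    by move=> I /andP[_ iI]; rewrite finset.setD1K.
  apply: eq_big => [J|J /andP[_ /eqP ->] //].
  rewrite cardsU1 setU11 andbT; have [iJ|iJ] := boolP (i \in J).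
    rewrite andbF; apply/negbTE/negP => /andP[_ /eqP /setP /(_ i)].
    by rewrite !inE eqxx iJ.
  by rewrite setU1K // eqxx !andbT.
rewrite (exchange_big_dep (fun J : {set 'I_n} => #|J|.+1 == k)) /=; last by move=> i J _ /andP[].
rewrite big1 // => J cJ; rewrite -mulr_sumr.
under eq_bigl => i do rewrite cJ /=.
rewrite sum_cyc_elt ?mulr0 //; apply: contraTneq lt_kn => JT.
by rewrite -(eqP cJ) JT cardsT card_ord -leqNgt.
Qed.

End Periodic.
End DecreasingSums.

(** * Factorizations into cyclically decreasing elements *)

Section Factorizations.
Variable n : nat.
Hypothesis n_gt1 : (1 < n)%N.
Implicit Types (w y z : affsym n) (p u v x : int) (a b : seq int).
Implicit Types (I J : {set 'I_n}) (m : nat -> nat).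
Local Notation s := (simple_refl n).
Local Notation word := (word n).
Local Notation full := (finset.setTfor 'I_n).
Local Notation residue := (residue n_gt1).
Local Notation residues := (residues n_gt1).
Local Notation cyc_elt := (cyc_elt n_gt1).
Local Notation cyc_dec_word := (cyc_dec_word n_gt1).
Local Notation decreasing_word := (decreasing_word n_gt1).

Lemma cyc_dec_word_catl a b u v : cyc_dec_word (a ++ b) -> u \in a -> v \in b ->
  residue u != residue v /\ residue (u + 1) != residue v.
Proof.
move=> + + vb; elim: a => //= x a IH /and3P[h1 h2 cd]; rewrite inE.
case/orP => [/eqP ->|/IH]; last exact.
have vab : residue v \in residues (a ++ b) by rewrite mem_residues // mem_cat vb orbT.
by split; [apply: contraNneq h1 => ->|apply: contraNneq h2 => ->].
Qed.

Lemma cyc_dec_word_nth a j k : cyc_dec_word a -> (j < k)%N -> (k < size a)%N ->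
  residue (a`_j + 1) != residue a`_k.
Proof.
rewrite -{1}(cat_take_drop k a) => cd jk ka.
apply: (cyc_dec_word_catl cd _ _).2.
  by rewrite -(nth_take 0 jk) mem_nth // size_take ka.
by rewrite -[k in a`_k]addn0 -nth_drop mem_nth // size_drop subn_gt0.
Qed.

Lemma reduced_cyc_dec_word a : len (word a) = size a ->
    (forall j k, (j < k)%N -> (k < size a)%N -> residue (a`_j + 1) != residue a`_k) ->
  cyc_dec_word a.
Proof.
elim: a => //= x a IH red dec.
have cd : cyc_dec_word a.
  apply: IH => [|j k jk ka]; last exact: (dec j.+1 k.+1).
  apply/eqP; rewrite eqn_leq len_word //= -ltnS -red word_cons.
  by rewrite (leq_trans (lenM _ _ _)) // -add1n leq_add2r len_simple.
have x1a : residue (x + 1) \notin residues a.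
  rewrite inE; apply/negP => /(nthP (residue 0))[k]; rewrite size_map => ka e.
  by have := dec 0%N k.+1 isT; rewrite ltnS ka -e (nth_map 0) //= eqxx => /(_ isT).
rewrite x1a cd !andbT; apply/negP; rewrite finset.inE => /mapP[v va xv].
move: red cd x1a; case/splitPr: va => b c red cd x1a.
(* If the class of [x] recurs at [v], then [x] commutes past [b] and cancels with [v], so the word
   was not reduced. *)
have : (len (word (x :: b ++ v :: c)) <= size (b ++ c))%N.
  rewrite word_cons word_cat word_cons.
  have /eqP := xv; rewrite residue_eq => /(simple_mod n_gt1) <-.
  rewrite mulgA (@word_commute _ x b) => [|u ub].
    by rewrite -mulgA (mulgA (s x)) simpleK // mul1g -word_cat len_word.
  have [h1 h2] := cyc_dec_word_catl cd ub (mem_head _ _).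
  rewrite -xv in h1 h2; apply: simple_comm => //; rewrite -(residue_eq n_gt1).
  - by rewrite eq_sym.
  - by apply: contraNneq x1a => ->; rewrite mem_residues // mem_cat ub.
  - by rewrite eq_sym.
by rewrite red !size_cat /=; lia.
Qed.

Lemma set0_neq_full : finset.set0 != full.
Proof.
apply/eqP => /setP /(_ (residue 0)).
by rewrite finset.in_set0 finset.in_setT.
Qed.

Lemma residues_neq_full a : cyc_dec_word a -> residues a != full.
Proof.
case: a => [_|x a /= /and3P[_ x1a _]].
  by apply: contraNneq set0_neq_full => <-; apply/eqP/setP => k; rewrite !inE.
apply: (@notin_neq_full _ _ (residue (x + 1))).
rewrite residues_cons in_setU1 negb_or x1a andbT residue_eq eqmod_sym.
exact: succ_neqmod.
Qed.

(** With [cyc_elt_inj], this turns factorizations into sequences of proper subsets. *)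
Lemma cyc_decreasingP w : cyc_decreasing w <-> exists2 I, I != full & w = cyc_elt I.
Proof.
split=> [[a /(reduced_wordP n_gt1)[wa sa] dec]|[I IT ->]].
  have cd : cyc_dec_word a.
    apply: reduced_cyc_dec_word => [|j k jk ka]; first by rewrite wa.
    apply: contraNneq (dec j k jk ka) => /eqP; rewrite residue_eq.
    by move/(simple_mod n_gt1) => ->.
  have rT := residues_neq_full cd; exists (residues a) => //.
  by rewrite -wa (word_cyc_dec cd (gapP n_gt1 rT)).
have cd := cyc_dec_decreasing_word n_gt1 (gap I) I.
exists (decreasing_word (gap I) I).
  apply/(reduced_wordP n_gt1); split=> //.
  by rewrite len_cyc_elt // size_decreasing_word // gapP.
move=> j k jk ka; apply: contraTneq (cyc_dec_word_nth cd jk ka) => /(simple_inj n_gt1).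
by rewrite -(residue_eq n_gt1) => /eqP ->; rewrite eqxx.
Qed.

Definition cyc_sets (k : nat) : seq {set 'I_n} :=
  enum [pred I : {set 'I_n} | (#|I| == k) && (I != full)].

Lemma cyc_elt_set0 : cyc_elt finset.set0 = 1%g.
Proof. by apply: (len_eq0 n_gt1); rewrite len_cyc_elt ?cards0 ?set0_neq_full. Qed.

Fixpoint factor_seqs m B : seq (seq {set 'I_n}) :=
  if B is B'.+1 then [seq rcons F J | F <- factor_seqs m B', J <- cyc_sets (m B')]
  else [:: [::]].

Definition factor_prod (F : seq {set 'I_n}) : affsym n := (\prod_(I <- F) cyc_elt I)%g.

Lemma factor_prod_rcons F I : factor_prod (rcons F I) = (factor_prod F * cyc_elt I)%g.
Proof. by rewrite /factor_prod -cats1 big_cat big_seq1. Qed.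

Lemma mem_factor_seqs m B F : reflect
  (size F = B /\ forall k, (k < B)%N ->
     (#|nth finset.set0 F k| == m k) && (nth finset.set0 F k != full))
  (F \in factor_seqs m B).
Proof.
elim: B F => [|B IH] F /=.
  rewrite inE; apply: (iffP eqP) => [->|[/size0nil]] //.
apply: (iffP allpairsP) => [[[G I] [/= /IH[sG hG]]]|[sF hF]].
  rewrite mem_enum inE => hI ->; split=> [|k kB]; first by rewrite size_rcons sG.
  rewrite nth_rcons sG; case: (ltngtP k B) => [/hG //|Bk|->]; last by [].
  by move: kB; rewrite ltnS leqNgt Bk.
case/lastP: F sF hF => // F I; rewrite size_rcons => -[sF] hF.
exists (F, I); split=> //=.
  apply/IH; split=> // k kB; have := hF k (ltnW kB).
  by rewrite nth_rcons sF kB.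
by have := hF B (ltnSn B); rewrite mem_enum inE nth_rcons sF ltnn eqxx.
Qed.

Lemma factor_seqs_uniq m B : uniq (factor_seqs m B).
Proof.
elim: B => //= B IH; apply: allpairs_uniq => //; first exact: enum_uniq.
by move=> [F I] [G J] _ _ /= /rcons_inj [-> ->].
Qed.

Lemma sum_factor_seqs m B (G : seq {set 'I_n} -> int) :
  \sum_(F <- factor_seqs m B.+1) G F =
  \sum_(F <- factor_seqs m B)
     \sum_(I : {set 'I_n} | (#|I| == m B) && (I != full)) G (rcons F I).
Proof.
by rewrite big_allpairs_dep; apply: eq_bigr => F _; rewrite big_enum.
Qed.

Lemma len_factor_prod m B F : F \in factor_seqs m B ->
  (len (factor_prod F) <= \sum_(k < B) m k)%N.
Proof.
elim: B F => [|B IH] F /=.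
  by rewrite inE => /eqP ->; rewrite /factor_prod big_nil len1 // big_ord0.
case/allpairsP => -[G I] [/= /IH hG]; rewrite mem_enum inE => /andP[/eqP cI IT] ->.
rewrite factor_prod_rcons big_ord_recr /= (leq_trans (lenM n_gt1 _ _)) //.
by rewrite leq_add // len_cyc_elt // cI.
Qed.

Lemma signed_cover_block y z p k : fpf_invol y -> fpf_invol z ->
  \sum_(I : {set 'I_n} | (#|I| == k) && (I != full))
    (len (z ^ cyc_elt I)%g == (len z + k.*2)%N)%:R * signed_cover y p (z ^ cyc_elt I)%g
  = \sum_(I : {set 'I_n} | (#|I| == k) && (I != full))
      ((len (y ^ (cyc_elt I)^-1)%g + k.*2)%N == len y)%:R
        * signed_cover (y ^ (cyc_elt I)^-1)%g (cyc_elt I p) z.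
Proof.
move=> fy fz.
pose G w : int := ((z ^ w)%g == y)%:R * (len y == (len z + k.-1.*2)%N)%:R.
(* The corrections from all [I] of size [k] are put in as a sum that is 0, after which the identity
   holds for each [I] separately. *)
rewrite -[RHS]addr0 -[X in _ + X](sum_delete_all n_gt1 (weight_periodic y p) G k).
rewrite -big_split; apply: eq_bigr => I /andP[/eqP cI IT].
have := signed_cover_word n_gt1 (decreasing_word (gap I) I) p fy fz.
rewrite -/(cyc_elt I) size_decreasing_word ?gapP // cI => ->; congr (_ + _).
rewrite -(sum_delete (weight_periodic y p) G IT erefl) /G.
by rewrite size_decreasing_word ?gapP // cI.
Qed.

(** The last factor is moved from the argument to the base, which changes [y] and [p]; hence both
    are quantified in the induction. *)
Lemma sum_signed_cover m B z : fpf_invol z ->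
    (forall y p, fpf_invol y -> signed_cover y p z = 0) ->
  forall y p, fpf_invol y ->
  \sum_(F <- factor_seqs m B)
    (len (z ^ factor_prod F)%g == (len z + (\sum_(k < B) m k).*2)%N)%:R
      * signed_cover y p (z ^ factor_prod F)%g = 0.
Proof.
move=> fz z0; elim: B => [|B IH] y p fy.
  by rewrite big_seq1 /factor_prod big_nil conjg1 z0 // mulr0.
rewrite sum_factor_seqs.
set S := (\sum_(k < B) m k)%N.
(* The total rise is maximal exactly when the first [B] factors and the last one each give their
   maximal rise. *)
transitivity (\sum_(F <- factor_seqs m B)
    (len (z ^ factor_prod F)%g == (len z + S.*2)%N)%:R *
  \sum_(I : {set 'I_n} | (#|I| == m B) && (I != full))
    (len ((z ^ factor_prod F) ^ cyc_elt I)%g ==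
       (len (z ^ factor_prod F)%g + (m B).*2)%N)%:R
     * signed_cover y p ((z ^ factor_prod F) ^ cyc_elt I)%g).
  rewrite big_seq [RHS]big_seq; apply: eq_bigr => F hF; rewrite mulr_sumr.
  apply: eq_bigr => I /andP[/eqP cI IT].
  rewrite factor_prod_rcons conjgM mulrA -natrM mulnb big_ord_recr /= -/S.
  congr ((nat_of_bool _)%:R * _).
  have := len_conj n_gt1 z (factor_prod F); have := len_factor_prod hF.
  have := len_conj n_gt1 (z ^ factor_prod F)%g (cyc_elt I).
  rewrite len_cyc_elt // cI -/S => h1 h2 h3.
  clearbody S; move: (len (z ^ factor_prod F)%g) (len ((z ^ factor_prod F) ^ _)%g)
    (len (factor_prod F)) (len z) (m B) h1 h2 h3 => a b c d e; clear => h1 h2 h3.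
  apply/eqP/andP => [E|[/eqP e1 /eqP e2]]; last by lia.
  by split; apply/eqP; lia.
under eq_bigr => F _ do rewrite (signed_cover_block _ _ fy (fpf_conj n_gt1 _ fz)) mulr_sumr.
rewrite exchange_big /=; apply: big1 => I _.
under eq_bigr => F _ do rewrite mulrCA.
by rewrite -mulr_sumr IH ?mulr0 //; apply: fpf_conj.
Qed.

(** * Coefficients of affine Stanley functions *)

Lemma prod_trivial_tail (f : nat -> affsym n) N d :
  (forall k, (N <= k)%N -> f k = 1%g) ->
  (\prod_(0 <= k < N + d) f k = \prod_(0 <= k < N) f k)%g.
Proof.
move=> f1; elim: d => [|d IH]; first by rewrite addn0.
by rewrite addnS big_nat_recr //= f1 ?leq_addr // mulg1.
Qed.

Lemma sum_trivial_tail (f : nat -> nat) N d :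
  (forall k, (N <= k)%N -> f k = 0%N) ->
  (\sum_(0 <= k < N + d) f k = \sum_(0 <= k < N) f k)%N.
Proof.
move=> f1; elim: d => [|d IH]; first by rewrite addn0.
by rewrite addnS big_nat_recr //= f1 ?leq_addr // addn0.
Qed.

Definition factors (F : seq {set 'I_n}) (k : nat) : affsym n :=
  nth 1%g (map cyc_elt F) k.

Lemma prod_factors F : (\prod_(0 <= k < size F) factors F k = factor_prod F)%g.
Proof. by rewrite /factor_prod -(big_map cyc_elt xpredT id) [RHS](big_nth 1%g) size_map. Qed.

(** Factors from index [B] on have length 0 and are trivial; the others correspond to proper subsets
    of the prescribed sizes. *)
Lemma affine_stanley_count w (m : monom) B : (forall k, (B <= k)%N -> m k = 0%N) ->
  affine_stanley w m =
  \sum_(F <- factor_seqs m B) ((factor_prod F == w) && (len w == \sum_(k < B) m k)%N)%:R.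
Proof.
move=> mB; pose P F := (factor_prod F == w) && (len w == \sum_(k < B) m k)%N.
transitivity (\sum_(F <- [seq F <- factor_seqs m B | P F]) (1 : int)); last first.
  by rewrite big_filter big_mkcond; apply: eq_bigr => F _; rewrite /P; case: ifP.
rewrite fsbig_seq ?filter_uniq ?factor_seqs_uniq // /affine_stanley.
have inj : set_inj [set` [seq F <- factor_seqs m B | P F]] factors.
  move=> F G; rewrite !inE /= !mem_filter => /andP[_ /mem_factor_seqs[sF hF]].
  move=> /andP[_ /mem_factor_seqs[sG hG]] e.
  apply: (@eq_from_nth _ finset.set0) => [|k kF]; first by rewrite sG.
  have := congr1 (fun f => f k) e; rewrite /factors.
  rewrite !(nth_map finset.set0) ?sG -?sF // => /cyc_elt_inj; apply.
    by rewrite sF in kF; case/andP: (hF k kF).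
  by rewrite sF in kF; case/andP: (hG k kF).
transitivity (\sum_(f \in (factors @` [set` [seq F <- factor_seqs m B | P F]])%classic) (1 : int));
  last by rewrite fsbig_image.
apply: eq_fsbigl.
apply/seteqP; split=> [f [[cd [N [fN pN lN]]] lm]|f [F]] /=; last first.
  rewrite mem_filter /P => /andP[/andP[/eqP pF /eqP lw] /mem_factor_seqs[sF hF]] <-.
  have fE k : (k < B)%N -> factors F k = cyc_elt (nth finset.set0 F k).
    by move=> kB; rewrite /factors (nth_map finset.set0) // sF.
  have f1 k : (B <= k)%N -> factors F k = 1%g.
    by move=> Bk; rewrite /factors nth_default // size_map sF.
  have lm k : len (factors F k) = m k.
    have [kB|Bk] := ltnP k B; last by rewrite f1 // mB // len1.
    by rewrite fE //; case/andP: (hF k kB) => /eqP <- IT; rewrite len_cyc_elt.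
  split=> //; split=> [k|].
    apply/cyc_decreasingP; have [kB|Bk] := ltnP k B.
      by exists (nth finset.set0 F k); rewrite ?fE //; case/andP: (hF k kB).
    by exists finset.set0; rewrite ?set0_neq_full // f1 // cyc_elt_set0.
  exists B; split=> //; first by rewrite -sF prod_factors.
  by rewrite lw big_mkord; apply: eq_bigr => k _; rewrite lm.
have /choice[I hI] : forall k, exists I, I != full /\ f k = cyc_elt I.
  by move=> k; have /cyc_decreasingP[I IT fk] := cd k; exists I.
have f1 k : (B <= k)%N -> f k = 1%g.
  by move=> Bk; apply: (len_eq0 n_gt1); rewrite lm mB.
have fF : factors (mkseq I B) = f.
  apply/funext => k; rewrite /factors; have [kB|Bk] := ltnP k B.
    by rewrite (nth_map finset.set0) ?size_mkseq // nth_mkseq // (hI k).2.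
  by rewrite nth_default ?f1 // size_map size_mkseq.
exists (mkseq I B) => //=; rewrite mem_filter /P; apply/andP; split; last first.
  apply/mem_factor_seqs; split=> [|k kB]; first by rewrite size_mkseq.
  by rewrite nth_mkseq // -lm (hI k).2 len_cyc_elt ?(hI k).1 // eqxx.
apply/andP; split; apply/eqP.
  (* [N] comes from the factorization and [B] from the monomial; both products equal the one up to
     [N + B]. *)
  rewrite -prod_factors size_mkseq fF -pN -(prod_trivial_tail N f1) addnC.
  by rewrite prod_trivial_tail.
rewrite -lN -(@sum_trivial_tail (fun k => len (f k)) N B) => [|k /fN ->]; last by rewrite len1.
rewrite addnC (sum_trivial_tail (f := fun k => len (f k))) => [|k /f1 ->]; last by rewrite len1.
by rewrite big_mkord; apply: eq_bigr => k _; rewrite lm.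
Qed.

End Factorizations.

(** * Atoms *)

Section Atoms.
Variable n : nat.
Hypothesis n_gt1 : (1 < n)%N.
Hypothesis n_even : ~~ odd n.
Implicit Types (w y z v : affsym n) (x i : int).
Local Notation s := (simple_refl n).

Definition Theta (c : nat) : affsym n :=
  (\prod_(0 <= k < n./2) simple_refl n (2 * k + c)%N%:Z)%g.

Lemma n_halfK : ((n./2).*2 = n)%N.
Proof. by rewrite even_halfK. Qed.

Lemma neqmod_nat (a b : nat) : (a < n)%N -> (b < n)%N -> a != b ->
  (a%:Z != b%:Z %[mod n])%Z.
Proof. by move=> an bn ab; rewrite !modz_nat !modn_small. Qed.

(** Within the window starting at [c] the factors swap disjoint pairs of neighbours, so each offset
    [r] is moved by at most one of them. *)
Lemma Theta_partial c j (r : nat) : (j <= n./2)%N -> (r < n)%N ->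
  (\prod_(0 <= k < j) simple_refl n (2 * k + c)%N%:Z)%g (r%:Z + c%:Z) =
  r%:Z + c%:Z + (if (r < j.*2)%N then (if odd r then -1 else 1) else 0).
Proof.
have nE := n_halfK.
elim: j r => [|j IH] r jn rn; first by rewrite big_nil addr0.
rewrite big_nat_recr //=.
rewrite (_ : (2 * j + c)%N%:Z = (j.*2)%:Z + c%:Z); last by lia.
have [e|ne] := eqVneq r j.*2.
  rewrite e simpleL // (_ : _ + 1 = (j.*2.+1)%:Z + c%:Z); last by lia.
  rewrite IH; [|lia|lia].
  have -> : (j.*2.+1 < j.*2)%N = false by lia.
  have -> : (j.*2 < j.+1.*2)%N by lia.
  by rewrite odd_double; lia.
have [e|ne1] := eqVneq r j.*2.+1.
  rewrite e (_ : j.*2.+1%:Z + c%:Z = (j.*2)%:Z + c%:Z + 1); last by lia.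
  rewrite simpleR // IH; [|lia|lia].
  have -> : (j.*2 < j.*2)%N = false by lia.
  have -> : (j.*2.+1 < j.+1.*2)%N by lia.
  by rewrite /= odd_double /=; lia.
rewrite simpleO //.
- rewrite IH //; last by lia.
  by congr (_ + _); rewrite (_ : (r < j.+1.*2)%N = (r < j.*2)%N) //; lia.
- by rewrite eqz_modDr neqmod_nat //; lia.
- rewrite addrAC eqz_modDr (_ : _ + 1 = (j.*2.+1)%:Z); last by lia.
  by rewrite neqmod_nat //; lia.
Qed.

Lemma dvd2_period (k : int) (r : nat) : (2 %| k * n%:Z + r%:Z)%Z = ~~ odd r.
Proof.
have -> : k * n%:Z = 2 * (k * (n./2)%:Z) by have := n_halfK; nia.
by move: (k * _) => q; lia.
Qed.

Lemma ThetaE c x : Theta c x = if (2 %| x - c%:Z)%Z then x + 1 else x - 1.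
Proof.
have ge0 := modz_ge0 (x - c%:Z) (n_neq0 n_gt1).
have lt_n := @ltz_pmod (x - c%:Z) n.
have := divz_eq (x - c%:Z) n; move: (_ %/ _)%Z => k.
case: (_ %% _)%Z ge0 lt_n => // r _ lt_n e.
have rn : (r < n)%N by lia.
have xE : x = r%:Z + c%:Z + k * n%:Z by lia.
have -> : (2 %| x - c%:Z)%Z = ~~ odd r.
  by rewrite e dvd2_period.
rewrite xE apZ Theta_partial // ifT; last by lia.
by case: (odd r) => /=; lia.
Qed.

Lemma Theta_fpf c : fpf_invol (Theta c).
Proof.
move=> x; rewrite [Theta c x]ThetaE; case: ifP => h; rewrite ThetaE.
  by rewrite ifF ?addrK; [split; lia|apply/negP => h'; lia].
by rewrite ifT ?subrK; [split; lia|lia].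
Qed.

Lemma sum_pairs (f : nat -> int) h :
  \sum_(0 <= i < h.*2) f i = \sum_(0 <= k < h) (f k.*2 + f k.*2.+1).
Proof.
elim: h => [|h IH]; first by rewrite !big_nil.
by rewrite doubleS !big_nat_recr //= IH addrA.
Qed.

(* A conjugating v would map each pair {2k, 2k + 1} to a pair {2J(k) - 1, 2J(k)};
   with h = n / 2, the sum of J(k) - k over a period of length h is divisible by h,
   while the normalization of v forces 4 times it to be 2h. *)
Lemma Theta_not_conj v : (Theta 1 ^ v)%g <> Theta 2.
Proof.
move=> e; have nE := n_halfK; set h := n./2 in nE.
have h_gt0 : (0 < h)%N by lia.
have comm x : v (Theta 2 x) = Theta 1 (v x).
  by rewrite -e conjgE -affsym_mulE mulVKg.
pose J (k : int) : int := ((v (2 * k) + 1) %/ 2)%Z.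
have pair k : v (2 * k + 1) = Theta 1 (v (2 * k)).
  by rewrite -comm ThetaE ifT //; lia.
have cases k : (v (2 * k) = 2 * J k /\ v (2 * k + 1) = 2 * J k - 1) \/
               (v (2 * k) = 2 * J k - 1 /\ v (2 * k + 1) = 2 * J k).
  rewrite pair ThetaE /J; case: ifP => hd; [right|left]; lia.
have Jp k : J (k + h%:Z) = J k + h%:Z.
  rewrite /J (_ : 2 * (k + h%:Z) = 2 * k + 1 * n%:Z); last by lia.
  by rewrite apZ; lia.
have JI : injective J.
  move=> k k' ek; case: (cases k) => -[e1 e2]; case: (cases k') => -[e1' e2'];
  rewrite -ek in e1' e2'.
  - by have /ap_inj := etrans e1 (esym e1'); lia.
  - by have /ap_inj := etrans e2 (esym e1'); lia.
  - by have /ap_inj := etrans e2 (esym e1'); lia.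
  - by have /ap_inj := etrans e1 (esym e1'); lia.
(* [J] permutes the classes modulo [h], so remainders cancel and only multiples of [h] survive. *)
have modJ := @sum_reindex h J (fun k => (k %% h%:Z)%Z) JI Jp (fun k => modzDr k h%:Z).
pose A : int := \sum_(1 <= k < h.+1) ((J k%:Z %/ h%:Z)%Z - (k%:Z %/ h%:Z)%Z).
have sumJ : \sum_(1 <= k < h.+1) (J k%:Z - k%:Z) = A * h%:Z.
  transitivity (\sum_(1 <= k < h.+1) (((J k%:Z %/ h%:Z)%Z - (k%:Z %/ h%:Z)%Z) * h%:Z
      + ((J k%:Z %% h%:Z)%Z - (k%:Z %% h%:Z)%Z))).
    apply: eq_bigr => k _; have := divz_eq (J k%:Z) h%:Z; have := divz_eq k%:Z h%:Z.
    by move=> e1 e2; rewrite [X in X - _ = _]e2 [X in _ - X = _]e1; ring.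
  by rewrite big_split /= sumrB modJ subrr addr0 -mulr_suml.
(* The window is shifted by one to consist of the whole pairs [2k, 2k + 1]. *)
have sumv : \sum_(1 <= i < n.+1) (v (i%:Z + 1) - (i%:Z + 1)) = 0.
  rewrite (@sum_reindex n (fun x => x + 1) (fun x => v x - x)).
  - by have [_ _ vs] := affsymP v; rewrite sumrB vs subrr.
  - exact: addIr.
  - by move=> x; rewrite addrAC.
  - by move=> x; have := apZ v x 1; rewrite mul1r => ->; lia.
move: sumv; rewrite big_add1 /=.
have := sum_pairs (fun i : nat => (v (i.+1%:Z + 1) - (i.+1%:Z + 1))%R) h; rewrite nE => ->.
under eq_bigr => k _.
  have -> : v ((k.*2).+1%:Z + 1) - ((k.*2).+1%:Z + 1) + (v ((k.*2).+2%:Z + 1) - ((k.*2).+2%:Z + 1))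
    = 4 * (J k.+1%:Z - k.+1%:Z) - 2.
    rewrite (_ : (k.*2).+1%:Z + 1 = 2 * k.+1%:Z); last by lia.
    rewrite (_ : (k.*2).+2%:Z + 1 = 2 * k.+1%:Z + 1); last by lia.
    by case: (cases k.+1%:Z) => -[-> ->]; lia.
  over.
rewrite sumrB -mulr_sumr sumr_const_nat subn0.
rewrite -[X in 4 * X](big_add1 _ _ 0%N h.+1 xpredT (fun k : nat => J k%:Z - k%:Z)) sumJ.
move=> E; have : (4 * A - 2) * h%:Z = 0 by lia.
move/eqP; rewrite mulf_eq0 => /orP[/eqP|/eqP]; lia.
Qed.

(** * Minimal involutions and atoms *)

Lemma no_descent_adjacent y : fpf_invol y ->
  (forall i, y i < y (i + 1) \/ y i = i + 1) ->
  forall x, y x = x + 1 \/ y x = x - 1.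
Proof.
move=> fy asc.
have up x : x < y x -> y x = x + 1.
  move=> lt_x; apply/eqP; apply: contraT => ne; exfalso.
  (* The first half excludes [y (x + k) = x + k + 1], so [y] keeps increasing from [x] on; at
     [x + k = y x] this contradicts [y (y x) = x]. *)
  have far (k : nat) : x + k%:Z + 1 < y (x + k%:Z) /\ y x <= y (x + k%:Z).
    elim: k => [|k [IH1 IH2]]; first by rewrite addr0; split; lia.
    rewrite (_ : x + k.+1%:Z = x + k%:Z + 1); last by lia.
    by case: (asc (x + k%:Z)) => h; split; lia.
  have := (far (absz (y x - x)%R)).2.
  rewrite (_ : x + _ = y x); last by lia.
  by rewrite fpfK //; lia.
move=> x; have [_ ne] := fy x; have := up x; have := up (y x); rewrite fpfK //.
by case: (ltrgtP x (y x)) => [h _ /(_ isT)|h /(_ isT) + _|/esym //]; [left|right; lia].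
Qed.

Lemma adjacent_Theta y (c : nat) : fpf_invol y ->
  (forall x, y x = x + 1 \/ y x = x - 1) -> y c%:Z = c%:Z + 1 -> y = Theta c.
Proof.
move=> fy adj yc.
have ev (k : nat) : y (c%:Z + k.*2%:Z) = c%:Z + k.*2%:Z + 1.
  elim: k => [|k IH]; first by rewrite addr0.
  have := fpfK (c%:Z + k.*2%:Z) fy; rewrite IH => h.
  case: (adj (c%:Z + k.+1.*2%:Z)) => // h'.
  have := fpfK (c%:Z + k.+1.*2%:Z) fy; rewrite h'.
  rewrite (_ : c%:Z + k.+1.*2%:Z - 1 = c%:Z + k.*2%:Z + 1); last by lia.
  by rewrite h; lia.
apply: affsym_ext => x; rewrite ThetaE.
have ge0 := modz_ge0 (x - c%:Z) (n_neq0 n_gt1).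
have := divz_eq (x - c%:Z) n; move: (_ %/ _)%Z => k.
case: (_ %% _)%Z ge0 => // r _ e.
have xE : x = c%:Z + r%:Z + k * n%:Z by lia.
have -> : (2 %| x - c%:Z)%Z = ~~ odd r.
  by rewrite e dvd2_period.
rewrite xE apZ; have := odd_double_half r; case: (odd r) => /= rE.
  have -> : c%:Z + r%:Z = c%:Z + (r./2).*2%:Z + 1 by lia.
  by rewrite -ev fpfK //; rewrite ev; lia.
by rewrite -rE add0n ev; lia.
Qed.

Lemma no_descent_Theta y : fpf_invol y ->
  (forall i, y i < y (i + 1) \/ y i = i + 1) -> y = Theta 1 \/ y = Theta 2.
Proof.
move=> fy /(no_descent_adjacent fy) adj.
case: (adj 1) => e; first by left; apply: adjacent_Theta.
(* With 1 paired to 0, the partner of 2 cannot be 1, so it is 3. *)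
right; apply: adjacent_Theta => //; case: (adj 2) => // e'.
by have := fpfK 2 fy; rewrite e' e.
Qed.

Definition is_Theta y := y = Theta 1 \/ y = Theta 2.

Lemma is_Theta_conj y z v : is_Theta y -> is_Theta z -> (y ^ v)%g = z -> y = z.
Proof.
case=> -> [] -> // e; exfalso; first exact: Theta_not_conj e.
by apply: (@Theta_not_conj v^-1%g); rewrite -e -conjgM mulgV conjg1.
Qed.

Lemma is_Theta_fpf y : is_Theta y -> fpf_invol y.
Proof. by case=> ->; apply: Theta_fpf. Qed.

(** Conjugating at descents lowers the length by 2 each time and stops at a Theta, which is [T]
    since the two are not conjugate. *)
Lemma atom_exists T y v : is_Theta T -> (T ^ v)%g = y ->
  exists2 w, (T ^ w)%g = y & len y = (len T + (len w).*2)%N.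
Proof.
move=> hT; have [N] := ubnP (len y); elim: N y v => // N IH y v lt_yN ey.
have fy : fpf_invol y by rewrite -ey; apply: fpf_conj => //; apply: is_Theta_fpf.
have [nodesc|/existsNP[i /not_orP[desc ne]]] :=
    EM (forall i, y i < y (i + 1) \/ y i = i + 1).
  have e := is_Theta_conj hT (no_descent_Theta fy nodesc) ey.
  by exists 1%g; rewrite ?conjg1 // e len1 // addn0.
have {}desc : y (i + 1) < y i.
  by move/negP: desc; rewrite -leNgt le_eqVlt => /orP[/eqP /ap_inj|//]; lia.
have [l _] := len_conj_desc n_gt1 fy desc ne.
have [||w ew lw] := IH (y ^ s i)%g (v * s i)%g; first by lia.
  by rewrite conjgM ey.
exists (w * s i)%g; first by rewrite conjgM ew conj_simpleK.
have : (len (w * s i)%g <= len w + len (s i))%N by apply: lenM.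
have := len_simple n_gt1 i.
have := len_conj n_gt1 T (w * s i)%g; rewrite conjgM ew conj_simpleK //.
by lia.
Qed.

Lemma len_Theta_min T w : is_Theta T -> (len T <= len (T ^ w)%g)%N.
Proof. by move=> hT; have [w' _ ->] := atom_exists hT (erefl (T ^ w)%g); rewrite leq_addr. Qed.

Lemma signed_cover_Theta T y p : is_Theta T -> signed_cover y p T = 0.
Proof.
move=> hT; suff h e : `[< cover_up e y p T >] = false by rewrite /signed_cover !h subrr.
apply/asboolPn => -[[j [_ _ jp _ eT]] l].
have := len_Theta_min (aff_refl n p j) hT; rewrite {2}eT -conjgM reflK ?conjg1; first by lia.
by rewrite eqmod_sym.
Qed.

(** Each letter adds at most 2 to the length, and [atom_exists] attains this bound, so minimality of
    [w] becomes an equation between lengths. *)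
Lemma fpf_atomsP z w : fpf_atoms z w <->
  exists2 T, is_Theta T & (T ^ w)%g = z /\ len z = (len T + (len w).*2)%N.
Proof.
have E (T u : affsym n) : (u^-1 * T * u = T ^ u)%g by rewrite conjgE mulgA.
have tE : Theta_plus n = Theta 1 /\ Theta_minus n = Theta 2 by [].
split=> [[T hT [ez min]]|[T hT [ez lz]]]; rewrite ?E in ez.
  have {}hT : is_Theta T by move: hT; rewrite tE.1 tE.2.
  exists T => //; split=> //.
  have [w' ew' lw'] := atom_exists hT ez.
  have le1 : (len w <= len w')%N by apply: min; rewrite E.
  by have := len_conj n_gt1 T w; rewrite ez; lia.
exists T; first by move: hT; rewrite /is_Theta -tE.1 -tE.2.
rewrite E; split=> // u; rewrite E => eu.
by have := len_conj n_gt1 T u; rewrite eu; lia.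
Qed.

End Atoms.

(** * The transition formula *)

Local Open Scope classical_set_scope.
Local Open Scope ring_scope.

Section Transition.
Variable n : nat.
Hypothesis n_gt1 : (1 < n)%N.
Implicit Types (w y z : affsym n) (p r x : int).
Local Notation residue := (residue n_gt1).

Lemma word_residue (a : seq int) :
  word n [seq (k : nat)%:Z | k : 'I_n <- map residue a] = word n a.
Proof.
elim: a => // x a IH; rewrite !map_cons !word_cons IH; congr (_ * _)%g.
by apply: simple_mod => //; rewrite -(residue_eq n_gt1) residue_ord.
Qed.

(** Supplies the finiteness of the index sets below, which is needed to take coefficients and
    exchange sums. *)
Lemma finite_len_le L : finite_set [set w : affsym n | (len w <= L)%N].
Proof.
pose f (b : L.-bseq 'I_n) := word n [seq (k : nat)%:Z | k : 'I_n <- b].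
apply: (@sub_finite_set _ _ (f @` setT)); last exact/finite_image/finite_finset.
move=> w /= le_wL; have [a wa sa] := ex_reduced n_gt1 w.
have sb : (size (map residue a) <= L)%N by rewrite size_map sa.
by exists (Bseq sb) => //; rewrite /f /= word_residue.
Qed.

Lemma sum_power_series (A : set (affsym n)) (F : affsym n -> power_series) (m : monom) :
  finite_set A -> (\sum_(w \in A) F w) m = \sum_(w \in A) F w m.
Proof.
by move=> finA; rewrite !fsbig_finite //; elim/big_rec2: _ => // w u v _ <-.
Qed.

Lemma sum_indicator (A : set (affsym n)) (P : pred (affsym n)) (x0 : affsym n) : finite_set A ->
  \sum_(z \in A) (((x0 == z) && P z)%:R : int) = (`[< A x0 >] && P x0)%:R.
Proof.
move=> finA; case: (asboolP (A x0)) => Ax /=.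
  rewrite (fsbigD1 x0) // eqxx fsbig1 ?Monoid.mulm1 // => z [_ /= ne].
  by case: eqP => // e; case: ne.
by rewrite fsbig1 // => z Az; case: eqP => // e; case: Ax; rewrite e.
Qed.

Lemma sum_exchange (A : set (affsym n)) (I : Type) (s : seq I) (F : affsym n -> I -> int) :
  finite_set A ->
  \sum_(z \in A) \sum_(i <- s) F z i = \sum_(i <- s) \sum_(z \in A) F z i.
Proof.
move=> finA; rewrite fsbig_finite // exchange_big.
by apply: eq_bigr => i _; rewrite fsbig_finite.
Qed.

Lemma monom_bound (m : monom) : exists B, forall k, (B <= k)%N -> m k = 0%N.
Proof.
exists (\max_(k <- finsupp m) k).+1 => k lt_k; apply/eqP; rewrite -memNfinsupp.
by apply: contraTN lt_k => km; rewrite -leqNgt; apply: (leq_bigmax_seq (F := id)).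
Qed.

Lemma fpf_lenE y z : fpf_len z = fpf_len y + 1 <-> len z = (len y).+2.
Proof.
rewrite /fpf_len; split=> [h|->]; last by rewrite -addn2 natrD; field.
have : (len z)%:R = (len y + 2)%:R :> rat by rewrite natrD; lra.
by move/eqP; rewrite eqr_nat => /eqP ->; rewrite addn2.
Qed.

(** The length condition of a cover supplies, through [conj_upI], the order of [y r] and [y j]. *)
Lemma Pi_cover_up e y r z : fpf_invol y ->
  (if e then Pi_plus y r z else Pi_minus y r z) <-> cover_up e y r z.
Proof.
move=> fy; split=> [|[[j [o1 o2 jr jyr ez]] l]].
  case: e => -[fz [_ /fpf_lenE l] [j [o jr jyr ez]]]; split=> //.
    have rj : (r != j %[mod n])%Z by rewrite eqmod_sym.
    by rewrite conj_refl // in ez; rewrite ez; apply: conj_upI => //; rewrite -ez l; lia.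
  rewrite conj_refl // reflC // in ez.
  by rewrite ez; apply: conj_upI => //; rewrite -ez l; lia.
have rj : (r != j %[mod n])%Z by rewrite eqmod_sym.
have fz : fpf_invol z by rewrite ez; apply: fpf_conj.
have fl : fpf_len z = fpf_len y + 1 by apply/fpf_lenE.
case: e o1 o2 => /= o1 o2; split=> //.
- split=> //; exists (aff_refl n r j); last by rewrite conj_refl.
  by exists r, j.
- by exists j; rewrite conj_refl.
- split=> //; exists (aff_refl n r j); last by rewrite conj_refl.
  by exists j, r; rewrite reflC.
- by exists j; rewrite reflC // conj_refl // reflC.
Qed.

Hypothesis n_even : ~~ odd n.
Local Notation thetas := [:: Theta n 1; Theta n 2].
Local Notation factor_seqs := (factor_seqs n).
Local Notation factor_prod := (factor_prod n_gt1).

Lemma finite_fpf_atoms z : finite_set (fpf_atoms z).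
Proof.
apply: sub_finite_set (finite_len_le (len z)) => w /= /fpf_atomsP.
by case=> // T _ [_ ->]; lia.
Qed.

Lemma fpf_stanley_count z (m : monom) B : (forall k, (B <= k)%N -> m k = 0%N) ->
  fpf_stanley z m = \sum_(F <- factor_seqs m B) \sum_(T <- thetas)
    (((T ^ factor_prod F)%g == z) && (len z == len T + (\sum_(k < B) m k).*2)%N)%:R.
Proof.
move=> mB; rewrite /fpf_stanley sum_power_series; last exact: finite_fpf_atoms.
under eq_fsbigr => w _ do rewrite (affine_stanley_count n_gt1 w mB).
rewrite sum_exchange; last exact: finite_fpf_atoms.
rewrite big_seq [RHS]big_seq; apply: eq_bigr => F hF.
rewrite (@sum_indicator _ (fun w => len w == \sum_(k < B) m k)%N); last first.
  exact: finite_fpf_atoms.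
have := len_factor_prod n_gt1 hF; set w := factor_prod F; set S := (\sum_(k < B) m k)%N.
move=> le_wS.
(* Both [len w <= S] and [len z <= len T + 2 len w] hold, so the combined equality forces each of
   them. *)
have atomE T : is_Theta T -> (T ^ w)%g = z ->
    (len z == len T + S.*2)%N = (len z == (len T + (len w).*2)%N) && (len w == S).
  move=> hT e; have := len_conj n_gt1 T w; rewrite e; clearbody S.
  move: (len z) (len T) (len w) le_wS => a b c h1 h2; clear - h1 h2; lia.
have disj : (Theta n 1 ^ w)%g = z -> (Theta n 2 ^ w)%g = z -> False.
  move=> <- /conjg_inj e.
  by apply: (Theta_not_conj n_gt1 n_even (v := 1%g)); rewrite conjg1.
rewrite big_cons big_seq1 -natrD; congr (_%:R).
have h1 : is_Theta (Theta n 1) by left.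
have h2 : is_Theta (Theta n 2) by right.
case: asboolP => [/fpf_atomsP|nat_].
  case=> // T hT [ez lz]; rewrite -ez; case: hT ez lz => -> ez lz.
    rewrite ez (atomE _ h1 ez) lz !eqxx /=.
    by have [/(disj ez)|_] := eqVneq (Theta n 2 ^ w)%g z; rewrite ?addn0.
  rewrite ez (atomE _ h2 ez) lz !eqxx /=.
  by have [/disj /(_ ez)|_] := eqVneq (Theta n 1 ^ w)%g z.
have none T : is_Theta T -> ((T ^ w)%g == z) && (len z == len T + S.*2)%N = false.
  move=> hT; apply/negP => /andP[/eqP ez]; rewrite (atomE _ hT ez) => /andP[/eqP lz _].
  by apply: nat_; apply/fpf_atomsP => //; exists T.
by rewrite !none.
Qed.

Lemma finite_cover_up e y p : finite_set [set z | cover_up e y p z].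
Proof.
by apply: sub_finite_set (finite_len_le (len y).+2) => z /= [_ ->].
Qed.

Lemma sum_fpf_stanley e y p (m : monom) B : (forall k, (B <= k)%N -> m k = 0%N) ->
  (\sum_(z \in [set z | cover_up e y p z]) fpf_stanley z) m =
  \sum_(T <- thetas) \sum_(F <- factor_seqs m B)
    (len (T ^ factor_prod F)%g == (len T + (\sum_(k < B) m k).*2)%N)%:R
      * (`[< cover_up e y p (T ^ factor_prod F)%g >])%:R.
Proof.
move=> mB; rewrite sum_power_series; last exact: finite_cover_up.
under eq_fsbigr => z _ do rewrite (fpf_stanley_count z mB).
rewrite sum_exchange; last exact: finite_cover_up.
rewrite [RHS]exchange_big; apply: eq_bigr => F _.
rewrite sum_exchange; last exact: finite_cover_up.
apply: eq_bigr => T _.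
rewrite (@sum_indicator _ (fun z => len z == len T + (\sum_(k < B) m k).*2)%N); last first.
  exact: finite_cover_up.
by rewrite -natrM mulnb andbC.
Qed.

(** Compare coefficients: at each monomial the difference is a sum of [signed_cover] over factor
    sequences for the two Thetas, and [sum_signed_cover] makes each part vanish. *)
Lemma fpf_transition y p : fpf_invol y ->
  \sum_(z \in Pi_minus y p) fpf_stanley z = \sum_(z \in Pi_plus y (y p)) fpf_stanley z.
Proof.
move=> fy.
have -> : Pi_minus y p = [set z | cover_up false y p z]%classic.
  by apply/seteqP; split=> z /(Pi_cover_up false p z fy).
have -> : Pi_plus y (y p) = [set z | cover_up true y p z]%classic.
  apply/seteqP; split=> z.
    move=> /(Pi_cover_up true (y p) z fy) [c l]; split=> //.
    by apply/(conj_up_other n_gt1 true p z fy).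
  move=> [c l]; apply/(Pi_cover_up true (y p) z fy); split=> //.
  by apply/(conj_up_other n_gt1 true p z fy).
apply/funext => m; have [B mB] := monom_bound m.
rewrite !(sum_fpf_stanley _ _ _ mB); apply/esym/eqP; rewrite -subr_eq0 -sumrB.
apply/eqP; rewrite big_cons big_seq1 -!sumrB.
suff h T : is_Theta T -> \sum_(F <- factor_seqs m B)
    ((len (T ^ factor_prod F)%g == (len T + (\sum_(k < B) m k).*2)%N)%:R
      * (`[< cover_up true y p (T ^ factor_prod F)%g >])%:R
    - (len (T ^ factor_prod F)%g == (len T + (\sum_(k < B) m k).*2)%N)%:R
      * (`[< cover_up false y p (T ^ factor_prod F)%g >])%:R) = 0 :> int.
  by rewrite (h _ (or_introl erefl)) (h _ (or_intror erefl)) addr0.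
move=> hT; under eq_bigr => F _ do rewrite -mulrBr.
apply: (sum_signed_cover n_gt1) => //; first exact: is_Theta_fpf.
by move=> *; apply: signed_cover_Theta.
Qed.

End Transition.

Theorem theorem5p8 (n : nat) (n_ge2 : (2 <= n)%N) (n_even : ~~ odd n)
    (y : affsym n) (y_fpf : fpf_invol y) (p q : int)
    (lt_pq : p < q) (q_def : q = y p) :
  \sum_(z \in Pi_minus y p) fpf_stanley z
    = \sum_(z \in Pi_plus y q) fpf_stanley z.
Proof. by rewrite q_def; apply: fpf_transition. Qed.
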